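(* Let $k$ be a $\sigma$-field, let $\mathcal G$ be an algebraic group over $k$ and let $G\leq\mathcal G$ be a $\sigma$-closed subgroup. For $i\geq 0$ let $G[i]$ denote the $i$-th order Zariski closure of $G$ in $\mathcal G$, and let $\mathbb I(G[i])\subseteq k[\mathcal G[i]]$ be its defining ideal. Then there exists an integer $m\geq 0$ such that for all $i>m$ $$\mathbb I(G[i])=\bigl(\mathbb I(G[i-1]),\,\sigma(\mathbb I(G[i-1]))\bigr)\subseteq k[\mathcal G[i]],$$ that is, $G[i]=\bigl(G[i-1]\times{}^{\sigma^i}\!\mathcal G\bigr)\cap\bigl(\mathcal G\times{}^{\sigma}(G[i-1])\bigr)$ as closed subgroups of $\mathcal G[i]$.
   Context: All rings are commutative and unital. A $\sigma$-ring is a ring with a ring endomorphism $\sigma$; a $\sigma$-field is a $\sigma$-ring that is a field. A $k$-$\sigma$-algebra is a $\sigma$-ring $R$ with a morphism of $\sigma$-rings $k\to R$. A $\sigma$-ideal is an ideal $\mathfrak a$ with $\sigma(\mathfrak a)\subseteq\mathfrak a$. An algebraic group over $k$ is an affine group scheme of finite type over $k$ (not necessarily reduced). For a scheme $\mathcal X$ over $k$, ${}^{\sigma^i}\!\mathcal X$ denotes its base change along $\sigma^i\colon k\to k$. Set $\mathcal G[i]=\mathcal G\times{}^{\sigma}\mathcal G\times\cdots\times{}^{\sigma^i}\!\mathcal G$. The projections $\mathcal G[i+1]\to\mathcal G[i]$ onto the first $i+1$ factors give inclusions $k[\mathcal G[i]]\subseteq k[\mathcal G[i+1]]$ of Hopf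 algebras, and $k\{\mathcal G\}=\bigcup_{i\ge0}k[\mathcal G[i]]$. Writing $k[{}^{\sigma^j}\!\mathcal G]=k[\mathcal G]\otimes_{k,\sigma^j}k$, the ring $k\{\mathcal G\}$ is a $k$-$\sigma$-algebra with $\sigma\bigl((r_0\otimes\lambda_0)\otimes\cdots\otimes(r_i\otimes\lambda_i)\bigr)=(1\otimes1)\otimes(r_0\otimes\sigma(\lambda_0))\otimes\cdots\otimes(r_i\otimes\sigma(\lambda_i))$, so $\sigma$ maps $k[\mathcal G[i-1]]$ into $k[\mathcal G[i]]$. It represents the functor $R\mapsto\mathcal G(R)$ from $k$-$\sigma$-algebras to groups ($R$ regarded as a $k$-algebra by forgetting $\sigma$). A $\sigma$-closed subgroup $G\leq\mathcal G$ is a subfunctor of this functor that is given by a $\sigma$-ideal $\mathbb I(G)\subseteq k\{\mathcal G\}$ (i.e. $G(R)=\{\psi\in\mathrm{Hom}(k\{\mathcal G\},R)\mid \mathbb I(G)\subseteq\ker\psi\}$) and such that $G(R)$ is a subgroup of $\mathcal G(R)$ for every $k$-$\sigma$-algebra $R$; then $\mathbb I(G)$ is a Hopf ideal. The $i$-th order Zariski closure $G[i]$ of $G$ in $\mathcal G$ is the closed subgroup of $\mathcal G[i]$ defined by the ideal $\mathbb I(G)\cap k[\mathcal G[i]]$. *)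

(* Defs.v *)
From HB Require Import structures.
From mathcomp Require Import all_boot all_algebra.
From mathcomp Require Import generic_quotient ring_quotient finmap.
From mathcomp Require Import boolp classical_sets.
From mathcomp.multinomials Require Import monalg.
From mathcomp.multinomials Require mpoly.

Set Implicit Arguments.
Unset Strict Implicit.
Unset Printing Implicit Defensive.

Import GRing.Theory.

Local Open Scope ring_scope.
Local Open Scope classical_set_scope.

Definition is_ideal (R : comNzRingType) (I : set R) : Prop :=
  [/\ I 0, forall x y, I x -> I y -> I (x + y) & forall a x, I x -> I (a * x)].

Definition ideal_gen (R : comNzRingType) (S : set R) : set R :=
  smallest (@is_ideal R) S.

Lemma ideal_gen_is_ideal (R : comNzRingType) (S : set R) :
  is_ideal (ideal_gen S).
Proof.
split=> [I [[I0 _ _] _] //|x y Sx Sy I HI|a x Sx I HI]; case: (HI.1) => _ ID IM.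
- by apply: ID; [apply: Sx|apply: Sy].
- by apply: IM; apply: Sx.
Qed.

Lemma ker_is_ideal (R S : comNzRingType) (f : {rmorphism R -> S}) :
  is_ideal [set x | f x = 0].
Proof.
split=> [|x y /= x0 y0|a x /= x0]; first exact: rmorph0.
- by rewrite rmorphD x0 y0 addr0.
- by rewrite rmorphM x0 mulr0.
Qed.

Lemma lrmorphism_eq (k : pzRingType) (A B : comAlgType k)
  (f g : {lrmorphism A -> B}) : f =1 g -> f = g.
Proof.
case: f g => [f [fz fl fs]] [g [gz gl gs]] /= /funext fg; subst g.
case: fz gz => fz [gz]; case: fl gl => fl [gl]; case: fs gs => fs [gs].
by rewrite (Prop_irrelevance fz gz) (Prop_irrelevance fl gl)
  (Prop_irrelevance fs gs).
Qed.

(* For X = Spec A and a morphism psi : A -> R, [vanishes_on psi I] says that    *)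
(* the R-point psi of X lies on the closed subscheme of X defined by I.         *)
Definition vanishes_on (A R : comNzRingType) (psi : A -> R) (I : set A) : Prop :=
  forall f, I f -> psi f = 0.

(* An algebraic group over k, i.e. an affine group scheme of finite type, not   *)
(* necessarily reduced: a finitely generated commutative k-algebra A together   *)
(* with a group structure on A(R) = Hom_k(A, R), natural in the k-algebra R.    *)
(* Naturality of the unit and of the inverse follows from that of the product.  *)
(* A comAlgType is a nonzero ring; nothing is lost, since Hom_k(A, 0) is a      *)
(* singleton and every affine group scheme has a nonzero coordinate ring.       *)
Record algGroup (k : fieldType) := AlgGroup {
  coord :> comAlgType k;
  coord_fg : exists n (x : 'I_n -> coord), forall a,
    exists p : mpoly.mpoly n k, a = mpoly.mmap (GRing.in_alg coord) x p;
  gone : forall R : comAlgType k, {lrmorphism coord -> R};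
  ginv : forall R : comAlgType k,
    {lrmorphism coord -> R} -> {lrmorphism coord -> R};
  gmul : forall R : comAlgType k,
    {lrmorphism coord -> R} -> {lrmorphism coord -> R} ->
    {lrmorphism coord -> R};
  gmulA : forall R, associative (@gmul R);
  gmul1 : forall R, left_id (@gone R) (@gmul R);
  gmulV : forall R, left_inverse (@gone R) (@ginv R) (@gmul R);
  gmul_nat : forall (R S : comAlgType k) (h : {lrmorphism R -> S})
    (x y : {lrmorphism coord -> R}),
    h \o gmul x y =1 gmul (h \o x : {lrmorphism coord -> S})
                          (h \o y : {lrmorphism coord -> S})
}.

(* A k-sigma-algebra, for the sigma-field (k, sigma). *)
Record diffAlg (k : fieldType) (sigma : {rmorphism k -> k}) := DiffAlg {
  diff_alg :> comAlgType k;
  diff_op : {rmorphism diff_alg -> diff_alg};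
  diff_op_alg : forall c : k, diff_op c%:A = (sigma c)%:A
}.

(* A variable of the polynomial ring k[V]; locked, since unification otherwise  *)
(* unfolds it down to finitely supported functions.                             *)
HB.lock Definition pvar (k : fieldType) (V : choiceType) (i : V) :
  {malg k[{cmonom V}]} := << ucm i >>.

Section PolyEval.
Context (V : choiceType) (S : comNzRingType) (v : V -> S).

Definition monev (m : {cmonom V}) : S := \prod_(i <- finsupp m) v i ^+ m i.

Lemma monevEw (d : {fset V}) (m : {cmonom V}) : (finsupp m `<=` d)%fset ->
  monev m = \prod_(i <- d) v i ^+ m i.
Proof.
move=> le; rewrite /monev (big_fset_incl _ le) //= => i _.
by rewrite memNfinsupp => /eqP->; rewrite expr0.
Qed.

Lemma monev_is_mult : monalg.mmorphism monev.
Proof.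
split=> [m1 m2|]; last by rewrite /monev mdom1 big_seq_fset0.
rewrite (@monevEw (finsupp m1 `|` finsupp m2)%fset) ?mdomD //.
rewrite (monevEw (fsubsetUl _ (finsupp m2))).
rewrite (monevEw (fsubsetUr (finsupp m1) _)).
by rewrite -big_split /=; apply: eq_bigr => i _; rewrite cmM exprD.
Qed.

HB.instance Definition _ :=
  monalg.isMultiplicative.Build {cmonom V} S monev monev_is_mult.

Lemma monevM m1 m2 : monev (mmul m1 m2) = monev m1 * monev m2.
Proof. exact: monalg.mmorphM. Qed.

Lemma monevU i : monev (ucm i) = v i.
Proof. by rewrite /monev mdomU big_seq_fset1 cmUU expr1. Qed.

End PolyEval.

Lemma malg_monev (k : fieldType) (V : choiceType) (c : k) (m : {cmonom V}) :
  << c *g m >> = c%:A * monev (@pvar k V) m.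
Proof.
have U (c1 c2 : k) (m1 m2 : {cmonom V}) :
    << c1 *g m1 >> * << c2 *g m2 >> = << c1 * c2 *g (mmul m1 m2) >>
    :> {malg k[{cmonom V}]}.
  exact: fgmulUU.
have -> : c%:A = << c *g (mone : {cmonom V}) >> :> {malg k[{cmonom V}]}.
  by rewrite -mul_malgC mulr1.
suff -> : monev (@pvar k V) m = << m >> by rewrite U mulr1 mul1m.
have [n] := ubnP (mdeg m); elim: n m => // n IH m.
have [->|] := eqVneq m mone; first by rewrite monalg.mmorph1.
rewrite -mdeg_eq0 => m_neq1.
have [i im] : exists i, i \in finsupp m.
  apply/fset0Pn; apply: contra m_neq1 => /eqP m0.
  by rewrite mdegE m0 big_seq_fset0.
have mE : m = mmul (ucm i) (divcm m (ucm i)).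
  apply/eqP/cmP => j; rewrite cmM divcmE subnKC // cmU.
  by case: eqVneq => // <-; rewrite lt0n cmE_neq0.
move: (divcm m (ucm i)) mE => m' -> {m m_neq1 im}.
rewrite mdegM mdegU add1n ltnS => /IH E.
rewrite monevM monevU E pvar.unlock; apply: etrans (U _ _ _ _) _.
congr (mkmalgU _ _); exact: mulr1.
Qed.

(* [twist_tensor sigma G e] is the tensor product over k of the k-algebras      *)
(* k[G] (x)_{k, sigma^(e j)} k, for j in J. It is the quotient of the           *)
(* polynomial ring in variables [tvar j a] (standing for a (x) 1 in the j-th    *)
(* factor) by the relations making each a |-> tvar j a a ring morphism that is  *)
(* semilinear along sigma^(e j).                                                *)
Section TwistTensor.
Context (k : fieldType) (sigma : {rmorphism k -> k}) (G : algGroup k).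
Context (J : choiceType) (e : J -> nat).

Definition tindex : choiceType := Choice.clone (J * coord G)%type _.

Local Notation tpoly := {malg k[{cmonom tindex}]}.

Definition tvar (j : J) (a : G) : tpoly := pvar k ((j, a) : tindex).

Definition trels : set tpoly :=
  [set p | exists j a b, p = tvar j (a + b) - (tvar j a + tvar j b)] `|`
  [set p | exists j a b, p = tvar j (a * b) - tvar j a * tvar j b] `|`
  [set p | exists j c, p = tvar j c%:A - (iter (e j) sigma c)%:A].

Definition tideal : {pred tpoly} := fun p => `[< ideal_gen trels p >].

Section EvalRels.
Context (S : comNzRingType) (tau : {rmorphism k -> S}).
Context (phi : J -> {rmorphism G -> S}).
Definition twist_semilinear : Prop :=
  forall j c, phi j c%:A = tau (iter (e j) sigma c).

Definition tpoly_eval : {rmorphism tpoly -> S} :=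
  mmap tau (monev (fun ja : tindex => phi ja.1 ja.2)).

Lemma tpoly_eval_var j a : tpoly_eval (tvar j a) = phi j a.
Proof.
by rewrite /tvar pvar.unlock /tpoly_eval/= mmapU/= rmorph1 mul1r monevU.
Qed.

Lemma tpoly_evalC c : tpoly_eval c%:A = tau c.
Proof. by rewrite /tpoly_eval/= mmapZ mmap1 mulr1. Qed.

Lemma tpoly_eval_ideal p : twist_semilinear -> tideal p -> tpoly_eval p = 0.
Proof.
move=> phi_semi /asboolP.
apply: (@smallest_sub _ _ _ [set p | tpoly_eval p = 0]).
  exact: ker_is_ideal.
move=> q [[|]|].
- move=> [j [a [b ->]]]; rewrite /mkset (rmorphB tpoly_eval) (rmorphD tpoly_eval).
  by rewrite !tpoly_eval_var (rmorphD (phi j)) subrr.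
- move=> [j [a [b ->]]]; rewrite /mkset (rmorphB tpoly_eval) (rmorphM tpoly_eval).
  by rewrite !tpoly_eval_var (rmorphM (phi j)) subrr.
- move=> [j [c ->]]; rewrite /mkset (rmorphB tpoly_eval) tpoly_eval_var.
  by rewrite tpoly_evalC phi_semi subrr.
Qed.

End EvalRels.

Definition counit : {lrmorphism G -> k^o} := gone G k^o.

Fact twist_counit n :
  {f : {rmorphism G -> k} | forall c, f c%:A = iter n sigma c}.
Proof.
elim: n => [|n [f fE]].
  exists (counit : {rmorphism G -> k}) => c.
  exact: etrans (rmorph_alg counit c) (mulr1 _).
by exists (sigma \o f : {rmorphism G -> k}) => c /=; rewrite fE.
Qed.

Lemma tideal_closed : idealr_closed tideal.
Proof.
have [I0 ID IM] := ideal_gen_is_ideal trels.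
split=> [||a x y]; first exact/asboolP.
- apply/negP => I1.
  have := @tpoly_eval_ideal _ idfun _ _ (fun j => svalP (twist_counit (e j))) I1.
  by rewrite rmorph1; apply/eqP/oner_neq0.
- move=> /asboolP Ix /asboolP Iy; apply/asboolP; apply: ID => //; exact: IM.
Qed.

HB.instance Definition _ := isIdealr.Build tpoly tideal tideal_closed.

Definition twist_tensor : Type := {ideal_quot tideal}.

HB.instance Definition _ := GRing.ComNzRing.on twist_tensor.

Fact tpi_key : unit. Proof. exact: tt. Qed.

Definition tpi : tpoly -> twist_tensor :=
  locked_with tpi_key \pi_({ideal_quot tideal})%qT.

Fact tpiE p : tpi p = \pi_({ideal_quot tideal})%qT p.
Proof. by rewrite /tpi locked_withE. Qed.

Lemma tpi_zmod : zmod_morphism tpi.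
Proof. by move=> x y; rewrite !tpiE !piE. Qed.
Lemma tpi_monoid : monoid_morphism tpi.
Proof. by split=> [|x y]; rewrite !tpiE !piE. Qed.

HB.instance Definition _ :=
  GRing.isZmodMorphism.Build tpoly twist_tensor tpi tpi_zmod.
HB.instance Definition _ :=
  GRing.isMonoidMorphism.Build tpoly twist_tensor tpi tpi_monoid.

Lemma tpi_surj x : exists p, tpi p = x.
Proof. by exists (repr (x : {ideal_quot tideal})); rewrite tpiE reprK. Qed.

Lemma tpi_eq0 p : ideal_gen trels p -> tpi p = 0.
Proof.
move=> Ip; apply: etrans (tpiE p) _.
transitivity (\pi_({ideal_quot tideal})%qT (0 : tpoly)).
  by apply/eqP; rewrite -Quotient.idealrBE subr0; apply/asboolP.
by rewrite !piE.
Qed.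

Definition tscale (c : k) (x : twist_tensor) : twist_tensor := tpi c%:A * x.

Fact tscaleA a b x : tscale a (tscale b x) = tscale (a * b) x.
Proof.
rewrite /tscale [LHS]mulrA; congr (_ * _); rewrite -(rmorphM tpi); congr tpi.
exact/esym/(rmorphM (GRing.in_alg tpoly)).
Qed.
Fact tscale1 : left_id 1 tscale.
Proof. by move=> x; rewrite /tscale scale1r (rmorph1 tpi) mul1r. Qed.
Fact tscaleDr : right_distributive tscale +%R.
Proof. by move=> a x y; rewrite /tscale mulrDr. Qed.
Fact tscaleDl x : {morph tscale^~ x : a b / a + b}.
Proof. by move=> a b; rewrite /tscale scalerDl (rmorphD tpi) mulrDl. Qed.
HB.instance Definition _ := GRing.Zmodule_isLmodule.Build k twist_tensor
  tscaleA tscale1 tscaleDr tscaleDl.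
Fact tscaleAl a (x y : twist_tensor) : a *: (x * y) = (a *: x) * y.
Proof. by rewrite /GRing.scale /= /tscale mulrA. Qed.
HB.instance Definition _ :=
  GRing.Lmodule_isLalgebra.Build k twist_tensor tscaleAl.
HB.instance Definition _ := GRing.Lalgebra_isComAlgebra.Build k twist_tensor.

Lemma tpiC c : tpi c%:A = c%:A.
Proof. by rewrite /GRing.scale /= /tscale mulr1. Qed.

Definition tin (j : J) (a : G) : twist_tensor := tpi (tvar j a).

Fact trel0 p : trels p -> tpi p = 0.
Proof. by move=> Rp; apply: tpi_eq0 => I [_]; apply. Qed.

Fact tinD j a b : tin j (a + b) = tin j a + tin j b.
Proof.
apply/eqP; rewrite -subr_eq0 /tin -(rmorphD tpi) -(rmorphB tpi); apply/eqP.
apply: trel0.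
by left; left; exists j, a, b.
Qed.

Fact tinM j a b : tin j (a * b) = tin j a * tin j b.
Proof.
apply/eqP; rewrite -subr_eq0 /tin -(rmorphM tpi) -(rmorphB tpi); apply/eqP.
apply: trel0.
by left; right; exists j, a, b.
Qed.

Lemma tinC j c : tin j c%:A = (iter (e j) sigma c)%:A.
Proof.
apply/eqP; rewrite -subr_eq0 /tin -tpiC -(rmorphB tpi); apply/eqP; apply: trel0.
by right; exists j, c.
Qed.

Fact iter_sigma1 n : iter n sigma 1 = 1.
Proof. by elim: n => //= n ->; rewrite rmorph1. Qed.

Fact tin_zmod j : zmod_morphism (tin j).
Proof.
move=> x y; apply/eqP; rewrite eq_sym subr_eq -tinD subrK; exact/eqP.
Qed.
Fact tin_monoid j : monoid_morphism (tin j).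
Proof.
by split=> [|x y]; [have := tinC j 1; rewrite iter_sigma1 !scale1r|exact: tinM].
Qed.
HB.instance Definition _ j :=
  GRing.isZmodMorphism.Build G twist_tensor (tin j) (tin_zmod j).
HB.instance Definition _ j :=
  GRing.isMonoidMorphism.Build G twist_tensor (tin j) (tin_monoid j).

Lemma reprtpi p : ideal_gen trels (p - repr (tpi p : {ideal_quot tideal})).
Proof.
apply/asboolP; rewrite -/(tideal _).
have -> : tideal (p - repr (tpi p : {ideal_quot tideal})) =
  (p - repr (tpi p : {ideal_quot tideal}) \in tideal) by [].
rewrite Quotient.idealrBE; apply/eqP.
by rewrite reprK; apply/esym/tpiE.
Qed.

Section Lift.
Context (S : comNzRingType) (tau : {rmorphism k -> S}).
Context (phi : J -> {rmorphism G -> S}) (phi_semi : twist_semilinear tau phi).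

Definition tlift_def of twist_semilinear tau phi : twist_tensor -> S :=
  fun x => tpoly_eval tau phi (repr (x : {ideal_quot tideal})).

Local Notation tlift := (tlift_def phi_semi).

Lemma tlift_pi p : tlift (tpi p) = tpoly_eval tau phi p.
Proof.
apply/esym/eqP; rewrite -subr_eq0 -(rmorphB (tpoly_eval tau phi)).
apply/eqP; apply: (tpoly_eval_ideal phi_semi).
apply/asboolP; exact: reprtpi.
Qed.

Fact tlift_zmod : zmod_morphism tlift.
Proof.
move=> x y; have [p <-] := tpi_surj x; have [q <-] := tpi_surj y.
by rewrite -(rmorphB tpi) !tlift_pi (rmorphB (tpoly_eval tau phi)).
Qed.

Fact tlift_monoid : monoid_morphism tlift.
Proof.
split=> [|x y]; first by rewrite -(rmorph1 tpi) tlift_pi (rmorph1 (tpoly_eval tau phi)).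
have [p <-] := tpi_surj x; have [q <-] := tpi_surj y.
by rewrite -(rmorphM tpi) !tlift_pi (rmorphM (tpoly_eval tau phi)).
Qed.

HB.instance Definition _ :=
  GRing.isZmodMorphism.Build twist_tensor S tlift tlift_zmod.
HB.instance Definition _ :=
  GRing.isMonoidMorphism.Build twist_tensor S tlift tlift_monoid.

Lemma tlift_in j a : tlift (tin j a) = phi j a.
Proof. by rewrite tlift_pi tpoly_eval_var. Qed.

Lemma tliftC c : tlift c%:A = tau c.
Proof. by rewrite -tpiC tlift_pi tpoly_evalC. Qed.

End Lift.

Section LiftAlg.
Context (S : comAlgType k) (phi : J -> {rmorphism G -> S}).
Context (phi_semi : twist_semilinear (GRing.in_alg S) phi).

Definition tlift_alg : twist_tensor -> S := tlift_def phi_semi.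

HB.instance Definition _ := GRing.RMorphism.on tlift_alg.

Fact tlift_alg_scalable : scalable tlift_alg.
Proof.
move=> c x; rewrite -mulr_algl (rmorphM tlift_alg) -[RHS]mulr_algl.
by congr (_ * _); apply: tliftC.
Qed.

HB.instance Definition _ :=
  GRing.isScalable.Build k twist_tensor S *:%R tlift_alg tlift_alg_scalable.

End LiftAlg.

Lemma twist_tensor_ext (S : comNzRingType)
    (f g : {rmorphism twist_tensor -> S}) :
  (forall c : k, f c%:A = g c%:A) -> (forall j a, f (tin j a) = g (tin j a)) ->
  f =1 g.
Proof.
move=> fgC fgin x; have [p <-] := tpi_surj x.
rewrite (monalgE p) (rmorph_sum tpi) (rmorph_sum f) (rmorph_sum g).
apply: eq_bigr => m _; rewrite malg_monev.
rewrite (rmorphM tpi) (rmorphM f) (rmorphM g); congr (_ * _).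
  by rewrite -[LHS]/(f (tpi _%:A)) -[RHS]/(g (tpi _%:A)) tpiC fgC.
rewrite /monev (rmorph_prod tpi) (rmorph_prod f) (rmorph_prod g).
apply: eq_bigr => -[j a] _.
rewrite (rmorphXn tpi) (rmorphXn f) (rmorphXn g); congr (_ ^+ _); exact: fgin.
Qed.

End TwistTensor.

Section TwistTensorMaps.
Context (k : fieldType) (sigma : {rmorphism k -> k}) (G : algGroup k).
Context (J J' : choiceType) (e : J -> nat) (e' : J' -> nat) (h : J -> J').

Local Notation T := (twist_tensor sigma G e).
Local Notation T' := (twist_tensor sigma G e').

Fact tincl_semilinear : (forall j, e' (h j) = e j) ->
  twist_semilinear sigma e (GRing.in_alg T') (fun j => tin sigma e' (h j)).
Proof. by move=> he j c; have := tinC sigma G e' (h j) c; rewrite he. Qed.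

Fact tshift_semilinear : (forall j, e' (h j) = (e j).+1) ->
  twist_semilinear sigma e (GRing.in_alg T' \o sigma)
    (fun j => tin sigma e' (h j)).
Proof. by move=> he j c; have := tinC sigma G e' (h j) c; rewrite he. Qed.

(* The k-algebra morphism mapping the j-th factor of T identically to the       *)
(* (h j)-th factor of T'.                                                       *)
Definition tincl (he : forall j, e' (h j) = e j) : T -> T' :=
  tlift_alg (tincl_semilinear he).

(* The sigma-semilinear ring morphism mapping r (x) lambda in the j-th factor   *)
(* of T to r (x) sigma(lambda) in the (h j)-th factor of T'.                    *)
Definition tshift (he : forall j, e' (h j) = (e j).+1) : T -> T' :=
  tlift_def (tshift_semilinear he).

HB.instance Definition _ he := GRing.LRMorphism.on (tincl he).
HB.instance Definition _ he := GRing.RMorphism.on (tshift he).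

Lemma tincl_in he j a : tincl he (tin sigma e j a) = tin sigma e' (h j) a.
Proof. exact: tlift_in. Qed.

Lemma tshift_in he j a : tshift he (tin sigma e j a) = tin sigma e' (h j) a.
Proof. exact: tlift_in. Qed.

Lemma tinclC he c : tincl he c%:A = c%:A.
Proof. exact: tliftC. Qed.

Lemma tshiftC he c : tshift he c%:A = (sigma c)%:A.
Proof. exact: tliftC. Qed.

End TwistTensorMaps.

Section DifferenceGroups.
Context (k : fieldType) (sigma : {rmorphism k -> k}) (G : algGroup k).

(* k[G[i]], the coordinate ring of G x sigma(G) x ... x sigma^i(G).             *)
Definition coord_prod (i : nat) : comAlgType k :=
  twist_tensor sigma G (fun j : 'I_i.+1 => j : nat).

(* k{G}, the union of the k[G[i]]; see coord_diff_inj and coord_diff_union.     *)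
Definition diff_coord : comAlgType k := twist_tensor sigma G (fun j : nat => j).

Definition coord_incl i : {lrmorphism coord_prod i -> coord_prod i.+1} :=
  tincl (h := widen_ord (leqnSn i.+1)) (fun=> erefl).

Definition coord_diff i : {lrmorphism coord_prod i -> diff_coord} :=
  tincl (h := @nat_of_ord i.+1) (fun=> erefl).

(* sigma on k{G}, and its restriction k[G[i]] -> k[G[i+1]].                     *)
Definition coord_shift i : {rmorphism coord_prod i -> coord_prod i.+1} :=
  tshift (h := lift ord0) (@lift0 i.+1).

Definition diff_shift : {rmorphism diff_coord -> diff_coord} :=
  tshift (h := succn) (fun=> erefl).

Fact diff_shiftC c : diff_shift c%:A = (sigma c)%:A.
Proof. exact: tshiftC. Qed.

Definition diff_coordAlg : diffAlg sigma :=
  @DiffAlg k sigma diff_coord diff_shift diff_shiftC.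

Lemma coord_diff_incl i x : coord_diff i.+1 (coord_incl i x) = coord_diff i x.
Proof.
apply: (twist_tensor_ext (f := coord_diff i.+1 \o coord_incl i)
                         (g := coord_diff i)) => [c|j a] /=.
  by rewrite !tinclC.
by rewrite !tincl_in.
Qed.

Lemma coord_diff_shift i x :
  coord_diff i.+1 (coord_shift i x) = diff_shift (coord_diff i x).
Proof.
apply: (twist_tensor_ext (f := coord_diff i.+1 \o coord_shift i)
                         (g := diff_shift \o coord_diff i)) => [c|j a] /=.
  by rewrite tshiftC !tinclC tshiftC.
by rewrite tshift_in !tincl_in tshift_in.
Qed.

Lemma coord_diff_inj i : injective (coord_diff i).
Proof.
pose S := coord_prod i.
pose phi j : {rmorphism G -> S} :=
  if insub j is Some o then tin sigma (fun j : 'I_i.+1 => j : nat) o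
  else GRing.in_alg S \o sval (twist_counit sigma G j).
have phi_semi : twist_semilinear sigma id (GRing.in_alg S) phi.
  move=> j c; rewrite /phi; case: insubP => [o _ <-|_]; first exact: tinC.
  by congr (_%:A); apply: (svalP (twist_counit sigma G j)).
apply: (can_inj (g := tlift_alg phi_semi)) => x.
apply: (twist_tensor_ext (f := tlift_alg phi_semi \o coord_diff i)
                         (g := idfun)) => [c|j a] /=.
  by rewrite tinclC; apply: tliftC.
by rewrite tincl_in [LHS]tlift_in /phi valK.
Qed.

Lemma coord_diff_union (f : diff_coord) : exists i x, coord_diff i x = f.
Proof.
have le_im i i' x : (i <= i')%N -> exists y, coord_diff i' y = coord_diff i x.
  elim: i' => [|i' IH]; first by rewrite leqn0 => /eqP<-; exists x.
  rewrite leq_eqVlt => /predU1P[<-|/IH[y <-]]; first by exists x.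
  by exists (coord_incl i' y); apply: coord_diff_incl.
pose P f := exists i x, coord_diff i x = f.
have P2 f1 f2 : P f1 -> P f2 -> exists i x1 x2,
    coord_diff i x1 = f1 /\ coord_diff i x2 = f2.
  move=> [i1 [x1 <-]] [i2 [x2 <-]].
  have [y1 <-] := le_im _ _ x1 (leq_maxl i1 i2).
  have [y2 <-] := le_im _ _ x2 (leq_maxr i1 i2).
  by exists (maxn i1 i2), y1, y2.
have PD f1 f2 : P f1 -> P f2 -> P (f1 + f2).
  move=> P1 P3; have [i [x1 [x2 [<- <-]]]] := P2 _ _ P1 P3.
  by exists i, (x1 + x2); rewrite (rmorphD (coord_diff i)).
have PM f1 f2 : P f1 -> P f2 -> P (f1 * f2).
  move=> P1 P3; have [i [x1 [x2 [<- <-]]]] := P2 _ _ P1 P3.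
  by exists i, (x1 * x2); rewrite (rmorphM (coord_diff i)).
have PC c : P c%:A by exists 0%N, c%:A; apply: tinclC.
have P1 : P 1 by have := PC 1; rewrite scale1r.
have P0 : P 0 by have := PC 0; rewrite scale0r.
have Pin j a : P (tin sigma id j a).
  exists j, (tin sigma (fun o : 'I_j.+1 => o : nat) ord_max a).
  exact: tincl_in.
have [p <-] := tpi_surj f.
rewrite (monalgE p) (rmorph_sum (@tpi _ _ _ _ _)).
apply: (big_ind P P0 PD) => m _; rewrite malg_monev (rmorphM (@tpi _ _ _ _ _)).
apply: (PM); first by rewrite -[X in P X]/(tpi _ _ _%:A) tpiC.
rewrite /monev (rmorph_prod (@tpi _ _ _ _ _)).
apply: (big_ind P P1 PM) => -[j a] _; rewrite (rmorphXn (@tpi _ _ _ _ _)).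
elim: (m _) => [|n IH]; first by rewrite expr0.
by rewrite exprS; apply: PM => //; apply: Pin.
Qed.

(* The embedding of k[G] = k[G[0]] into k{G}.                                   *)
Definition diff_in : G -> diff_coord := tin sigma id 0%N.

(* k{G} represents the functor R |-> G(R) on k-sigma-algebras.                  *)
Lemma diff_coord_represents (R : diffAlg sigma) (g : {lrmorphism G -> R}) :
  exists! psi : {lrmorphism diff_coord -> R},
    (forall f, psi (diff_shift f) = diff_op R (psi f)) /\
    (forall a, psi (diff_in a) = g a).
Proof.
have phiP j : {f : {rmorphism G -> R} | forall a, f a = iter j (diff_op R) (g a)}.
  elim: j => [|j [f fE]]; first by exists (g : {rmorphism G -> R}).
  by exists (diff_op R \o f : {rmorphism G -> R}) => a /=; rewrite fE.
pose phi j := sval (phiP j).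
have phi_semi : twist_semilinear sigma id (GRing.in_alg R) phi.
  move=> j c; rewrite /phi (svalP (phiP j)).
  rewrite (rmorph_alg g); elim: j => //= j ->; exact: diff_op_alg.
pose psi : {lrmorphism diff_coord -> R} := tlift_alg phi_semi.
exists psi; split.
  split=> [f|a]; last by rewrite /psi [LHS]tlift_in /phi (svalP (phiP 0%N)).
  apply: (twist_tensor_ext (f := psi \o diff_shift)
                           (g := diff_op R \o psi)) => [c|j a] /=.
    have psiC b : psi b%:A = b%:A by apply: tliftC.
    apply: etrans (congr1 psi (diff_shiftC c)) _; rewrite [LHS]psiC.
    apply/esym; exact: etrans (congr1 (diff_op R) (psiC c)) (diff_op_alg R c).
  have psiin i : psi (tin sigma id i a) = phi i a by apply: tlift_in.
  have shiftin : diff_shift (tin sigma id j a) = tin sigma id j.+1 a.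
    exact: tshift_in.
  apply: etrans (congr1 psi shiftin) _; rewrite [LHS]psiin.
  apply/esym; apply: etrans (congr1 (diff_op R) (psiin j)) _.
  by rewrite /phi (svalP (phiP j.+1)) (svalP (phiP j)).
move=> psi' [psi'S psi'in]; apply: lrmorphism_eq.
apply: (twist_tensor_ext (f := psi) (g := psi')) => [c|j a].
  exact: etrans (rmorph_alg psi c) (esym (rmorph_alg psi' c)).
apply: etrans (tlift_in phi_semi j a) _; rewrite /phi (svalP (phiP j)).
elim: j => [|j IH]; first exact/esym/psi'in.
apply: etrans (congr1 (diff_op R) IH) _; rewrite -psi'S.
apply: congr1; exact: tshift_in.
Qed.

Definition is_sigma_ideal (I : set diff_coord) : Prop :=
  is_ideal I /\ forall f, I f -> I (diff_shift f).

(* The R-points of the subfunctor of R |-> G(R) = Hom_k(k[G], R) defined by I:  *)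
(* a sigma-morphism psi is identified with its restriction to k[G].             *)
Definition diff_points (I : set diff_coord) (R : diffAlg sigma) :
    set {lrmorphism G -> R} :=
  [set g | exists psi : {lrmorphism diff_coord -> R},
    [/\ forall f, psi (diff_shift f) = diff_op R (psi f),
        forall a, psi (diff_in a) = g a
      & vanishes_on psi I]].

Arguments diff_points : clear implicits.

Definition sigma_closed_subgroup (I : set diff_coord) : Prop :=
  is_sigma_ideal I /\
  forall R : diffAlg sigma,
    [/\ diff_points I R (gone G R),
        forall x y, diff_points I R x -> diff_points I R y ->
          diff_points I R (gmul x y)
      & forall x, diff_points I R x -> diff_points I R (ginv x)].

(* The ideal of the i-th order Zariski closure, i.e. the intersection of I      *)
(* with k[G[i]].                                                                *)
Definition zclosure (I : set diff_coord) (i : nat) : set (coord_prod i) :=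
  coord_diff i @^-1` I.

End DifferenceGroups.

Arguments zclosure {k sigma G} I i _.
Arguments diff_points {k sigma G} I R _.

(* Main.v *)
Require Import Defs.
From HB Require Import structures.
From mathcomp Require Import all_boot all_order all_algebra.
From mathcomp Require Import generic_quotient ring_quotient finmap.
From mathcomp Require Import boolp classical_sets.
From mathcomp.multinomials Require Import monalg.
From mathcomp.multinomials Require mpoly.

Set Implicit Arguments.
Unset Strict Implicit.
Unset Printing Implicit Defensive.

Import Order.TTheory GRing.Theory.

Local Open Scope ring_scope.
Local Open Scope classical_set_scope.

(** Let GG be the ambient algebraic group and G its subgroup with ideal I.
    Fix i, put A = k[GG[i+1]], and let b be the ideal generated by I(G[i]) and
    sigma(I(G[i])) in A, so that b is contained in a = I(G[i+1]).  Both ideals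
    define closed subgroups of GG[i+1], and the claim is that these subgroups
    are equal for large i.  They are compared through the projection of
    GG[i+1] onto its first i+1 factors.

    - They have the same scheme-theoretic image G[i]: both a and b meet
      k[GG[i]] in I(G[i]).

    - For large i they have the same kernel.  The kernels are closed subgroups
      of the last factor of GG[i+1], the twist of GG by sigma^(i+1), and their
      ideals are the images of a and b under [last_factor].  The images of the
      I(G[i]) form a sequence of ideals, each of which is mapped into the next
      one by sigma.  Written in terms of generators of k[GG], this is a sequence
      of ideals of one polynomial ring, stable under the action of sigma on the
      coefficients.  That action preserves leading monomials, so the sets of
      leading monomials increase; by Dickson's lemma they are eventually
      constant, and from then on each ideal is generated by the image of the
      previous one ([twisted_ideal_chain]).  This gives the inclusion of a in
      b + (I_e) A, where I_e is the augmentation ideal of k[GG[i]]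
      ([last_factor_chain], [last_factor_kernel]).

    - Nested closed subgroups with the same image and the same kernel are equal
      ([equal_of_same_kernel_image]).  Usually this is deduced from the
      faithful flatness of a Hopf algebra over a Hopf subalgebra; the argument
      used here is elementary.  Let C = A/b and D = A/a, and let B be the ring
      of functions on the common image, a subring of both.  Take a finite
      family w in A whose span is stable under right translations, and consider
      its relations with coefficients in B, modulo b or modulo a.  Translation
      by a point of the smaller subgroup turns a relation into another one, so
      the rows of relations evaluated at the identity determine all relations
      over D ([relation_twist]): the rank is the same everywhere.  The
      hypothesis on the kernels says that, after enlarging w, the relations
      modulo a and those modulo b have the same values at the identity.
      Cramer's rule over D, whose coefficients lie in B, then produces a single
      d in B with value 1 at the identity such that d f is in b for every f of
      a in the span of w ([annihilator]).  Hence d(xy) f(x) = 0 for x in the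
      larger and y in the smaller subgroup; separating the variables, this still
      holds for y = x^-1, and f = 0 on the larger subgroup.

    The hypothesis on G only concerns points with values in k-sigma-algebras.
    That every I(G[i]) defines a subgroup on points with values in arbitrary
    k-algebras follows from the universal pair of points of G, with values in
    the tensor square of k{GG}/I(G), which is a k-sigma-algebra
    ([zclosure_mul]).

    Separation of variables always has the same form: an identity between
    functions on a product X x Y can be tested by applying linear forms to the
    functions on Y ([tensor_contract], [pairing_eq0]). *)

(** * Linear forms *)

Section LinearForms.
Context (k : fieldType) (V : lmodType k).

Let lin_closed (X : set V) := forall a x y, X x -> X y -> X (a *: x + y).

(** A subspace maximal among those that avoid v is a hyperplane complementary to
    the line of v. *)
Lemma exists_functional (v : V) : v != 0 -> exists l : {scalar V}, l v = 1.
Proof.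
move=> v0.
(* The empty set is closed under a x + y, so that the empty chain needs no special
   treatment. *)
have [|M [[Ml Mv] Mmax]] := @Zorn_bigcup V [set X | lin_closed X /\ ~ X v].
  move=> F FP Ftot; split=> [a x y [X FX Xx] [Y FY Yy]|[X FX Xv]]; last first.
    by have [_] := FP X FX; apply.
  have [XY|YX] := Ftot X Y FX FY.
    by exists Y => //; apply: (FP Y FY).1 => //; apply: XY.
  by exists X => //; apply: (FP X FX).1 => //; apply: YX.
have M0 : M 0.
  have [//|M0] := pselect (M 0); exfalso.
  apply: (Mmax [set 0]); last first.
    split=> [a x y /= -> ->|/= v0']; first by rewrite scaler0 addr0.
    by rewrite v0' eqxx in v0.
  have Me x : ~ M x 
    by move=> Mx; apply: M0; have := Ml (-1) x x Mx Mx; rewrite scaleN1r addNr.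
  split; first by move=> x /Me.
  by move=> /(_ 0 erefl).
have MZ a x : M x -> M (a *: x) by move=> Mx; rewrite -[_ *: _]addr0; apply: Ml.
have MD x y : M x -> M y -> M (x + y) by move=> Mx My; rewrite -[x]scale1r; apply: Ml.
have dec u : exists c, M (u - c *: v).
  have [Mu|Mu] := pselect (M u); first by exists 0; rewrite scale0r subr0.
  pose M' := [set x | exists m a, M m /\ x = m + a *: u].
  have [|M'v] := pselect (M' v); last first.
    exfalso; apply: (Mmax M'); last first.
      split=> // a _ _ [m [b [Mm ->]]] [m' [b' [Mm' ->]]].
      exists (a *: m + m'), (a * b + b'); split; first exact: Ml.
      by rewrite scalerDr scalerDl scalerA addrACA.
    split; first by move=> x Mx; exists x, 0; rewrite scale0r addr0.
    by move=> /(_ u) M'M; apply: Mu; apply: M'M; exists 0, 1; rewrite scale1r add0r.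
  move=> [m [a [Mm vE]]].
  have a0 : a != 0.
    by apply/eqP => a0; apply: Mv; rewrite vE a0 scale0r addr0.
  exists a^-1; rewrite vE scalerDr scalerA mulVf // scale1r opprD addrCA subrr addr0.
  by rewrite -scaleNr; apply: MZ.
have decU u c c' : M (u - c *: v) -> M (u - c' *: v) -> c = c'.
  move=> Mc Mc'; apply/eqP; rewrite -subr_eq0; apply: contrapT => /negP cc'.
  apply: Mv; rewrite -[v]scale1r -(mulVf cc') -scalerA; apply: (MZ).
  have -> : (c - c') *: v = (u - c' *: v) - (u - c *: v).
    by rewrite opprB [RHS]addrC addrA subrK scalerBl.
  by apply: MD => //; rewrite -scaleN1r; apply: MZ.
pose l u := projT1 (cid (dec u)).
have lP u : M (u - l u *: v) := projT2 (cid (dec u)).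
have l_lin : scalar l.
  move=> a x y; apply: (decU (a *: x + y)); first exact: lP.
  rewrite scalerDl -scalerA opprD addrACA -scalerBr.
  by apply: Ml; apply: lP.
pose L := GRing.isLinear.Build k V k *%R l l_lin.
pose l' : {scalar V} := HB.pack l L.
exists l'; apply: (decU v) (lP v) _.
by rewrite scale1r subrr.
Qed.

Lemma functionals_separate (v : V) : (forall l : {scalar V}, l v = 0) -> v = 0.
Proof.
move=> lv; apply/eqP; apply: contrapT => /negP/exists_functional[l].
by rewrite lv => /esym/eqP; rewrite oner_eq0.
Qed.

(** Extracts from a finite family g a basis b of its span, with linear forms on
    the whole space that restrict to the dual basis.  That b is expressed through
    g matters when g lies in a subring: then so does b. *)
Lemma finite_dual_basis n (g : 'I_n -> V) :
  exists r (b : 'I_r -> V) (l : 'I_r -> {scalar V}) (d : 'I_r -> 'I_n -> k),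
    [/\ forall p q, l p (b q) = (p == q)%:R,
        forall i, g i = \sum_p l p (g i) *: b p
      & forall p, b p = \sum_i d p i *: g i].
Proof.
elim: n g => [|n IH] g.
  exists 0%N, (fun=> 0), (fun=> (\0 : {scalar V})), (fun _ _ => 0).
  by split=> -[].
have [r [b [l [d [lb gE bE]]]]] := IH (fun i => g (lift ord0 i)).
pose proj x := x - \sum_p l p x *: b p.
have proj_b q : proj (b q) = 0.
  rewrite /proj (bigD1 q) //= big1 => [|p pq]; last first.
    by rewrite lb (negPf pq) scale0r.
  by rewrite addr0 lb eqxx scale1r subrr.
have l_proj q x : l q (proj x) = 0.
  rewrite /proj linearB linear_sum /= (bigD1 q) //= big1 => [|p pq]; last first.
    by rewrite linearZ /= lb eq_sym (negPf pq) mulr0.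
  by rewrite addr0 linearZ /= lb eqxx mulr1 subrr.
have proj_g i : proj (g (lift ord0 i)) = 0 by rewrite /proj -gE subrr.
have g0E : g ord0 = proj (g ord0) + \sum_p l p (g ord0) *: b p by rewrite subrK.
(* If the new vector is not in the span of the previous ones, its component
   outside the span is added to the basis, and a linear form that is 1 on it,
   composed with the projection, kills the other basis vectors. *)
have [h0|h0] := eqVneq (proj (g ord0)) 0.
  exists r, b, l, (fun p i => if unlift ord0 i is Some j then d p j else 0).
  split=> // [i|p].
    by case: (unliftP ord0 i) => [j|] -> //; rewrite {1}g0E h0 add0r.
  rewrite big_ord_recl unlift_none scale0r add0r bE.
  by apply: eq_bigr => i _; rewrite liftK.
have [mu muh] := exists_functional h0.
have nu_lin : scalar (fun x => mu (proj x)).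
  move=> a x y /=; rewrite -linearP; congr (mu _); rewrite /proj scalerBr.
  rewrite addrACA -opprD scaler_sumr -big_split /=; congr (_ - _).
  by apply: eq_bigr => p _; rewrite linearP scalerDl scalerA.
pose nu : {scalar V} := HB.pack (fun x => mu (proj x))
  (GRing.isLinear.Build k V k *%R (fun x => mu (proj x)) nu_lin).
have nuE x : nu x = mu (proj x) by [].
exists r.+1, (fun p => if unlift ord0 p is Some q then b q else proj (g ord0)).
exists (fun p => if unlift ord0 p is Some q then l q else nu).
exists (fun p i => if unlift ord0 p is Some q then
    if unlift ord0 i is Some j then d q j else 0
  else if unlift ord0 i is Some j then - \sum_q l q (g ord0) * d q j else 1).
split=> [p q|i|p].
- case: (unliftP ord0 p) => [p'|] ->; case: (unliftP ord0 q) => [q'|] ->.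
  + by rewrite lb.
  + exact: l_proj.
  + by rewrite nuE proj_b linear0.
  + have proj2 : proj (proj (g ord0)) = proj (g ord0).
      by rewrite {1}/proj big1 ?subr0 // => p' _; rewrite l_proj scale0r.
    by rewrite nuE proj2 muh.
- rewrite big_ord_recl unlift_none nuE.
  under eq_bigr do rewrite liftK.
  case: (unliftP ord0 i) => [j|] ->.
    by rewrite proj_g linear0 scale0r add0r -gE.
  by rewrite muh scale1r -g0E.
- rewrite big_ord_recl; case: (unliftP ord0 p) => [q _|_].
    by rewrite unlift_none scale0r add0r bE; apply: eq_bigr => i _; rewrite liftK.
  rewrite unlift_none scale1r /proj; congr (_ + _).
  under [RHS]eq_bigr do rewrite liftK scaleNr scaler_suml.
  rewrite sumrN exchange_big /=; congr (- _).
  apply: eq_bigr => q _; rewrite bE scaler_sumr.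
  by apply: eq_bigr => i _; rewrite scalerA.
Qed.

End LinearForms.

(** * Quotient algebras *)

Section QuotientAlgebra.
Context (k : fieldType) (A : comAlgType k) (I : set A).
Context (I_ideal : is_ideal I) (I_proper : ~ I 1).

(** The two proofs are arguments so that the structure of the quotient can be
    inferred from the predicate. *)
Definition ideal_pred of is_ideal I & ~ I 1 : {pred A} := fun x => `[< I x >].

Local Notation J := (ideal_pred I_ideal I_proper).

Fact ideal_pred_closed : idealr_closed J.
Proof.
have [I0 ID IM] := I_ideal; split=> [||a x y]; first exact/asboolP.
  exact/asboolP.
by move=> /asboolP Ix /asboolP Iy; apply/asboolP; apply: ID => //; apply: IM.
Qed.

HB.instance Definition _ := isIdealr.Build A J ideal_pred_closed.

Definition quot_alg : Type := {ideal_quot J}.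

HB.instance Definition _ := GRing.ComNzRing.on quot_alg.

Definition quot_pi (x : A) : quot_alg := \pi_({ideal_quot J})%qT x.

Fact quot_pi_zmod : zmod_morphism quot_pi.
Proof. by move=> x y; rewrite /quot_pi !piE. Qed.
Fact quot_pi_monoid : monoid_morphism quot_pi.
Proof. by split=> [|x y]; rewrite /quot_pi !piE. Qed.

HB.instance Definition _ :=
  GRing.isZmodMorphism.Build A quot_alg quot_pi quot_pi_zmod.
HB.instance Definition _ :=
  GRing.isMonoidMorphism.Build A quot_alg quot_pi quot_pi_monoid.

Definition quot_scale (c : k) (x : quot_alg) : quot_alg := quot_pi c%:A * x.

Fact quot_scaleA a b x : quot_scale a (quot_scale b x) = quot_scale (a * b) x.
Proof.
rewrite /quot_scale mulrA -rmorphM; congr (quot_pi _ * _).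
by rewrite -scalerAl mul1r scalerA.
Qed.
Fact quot_scale1 : left_id 1 quot_scale.
Proof. by move=> x; rewrite /quot_scale scale1r rmorph1 mul1r. Qed.
Fact quot_scaleDr : right_distributive quot_scale +%R.
Proof. by move=> a x y; rewrite /quot_scale mulrDr. Qed.
Fact quot_scaleDl x : {morph quot_scale^~ x : a b / a + b}.
Proof. by move=> a b; rewrite /quot_scale scalerDl rmorphD mulrDl. Qed.
HB.instance Definition _ := GRing.Zmodule_isLmodule.Build k quot_alg
  quot_scaleA quot_scale1 quot_scaleDr quot_scaleDl.
Fact quot_scaleAl a (x y : quot_alg) : a *: (x * y) = (a *: x) * y.
Proof. exact: mulrA. Qed.
HB.instance Definition _ := GRing.Lmodule_isLalgebra.Build k quot_alg quot_scaleAl.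
HB.instance Definition _ := GRing.Lalgebra_isComAlgebra.Build k quot_alg.

Fact quot_pi_scalable : scalable quot_pi.
Proof.
move=> c x; rewrite -[LHS]/(quot_pi (c *: x)) -mulr_algl rmorphM.
by [].
Qed.
HB.instance Definition _ :=
  GRing.isScalable.Build k A quot_alg *:%R quot_pi quot_pi_scalable.

Lemma quot_pi_eq0 x : quot_pi x = 0 <-> I x.
Proof.
have -> : 0 = quot_pi 0 by rewrite raddf0.
split=> [/eqP|Ix].
  by rewrite /quot_pi -Quotient.idealrBE subr0 => /asboolP.
by apply/eqP; rewrite /quot_pi -Quotient.idealrBE subr0; apply/asboolP.
Qed.

Lemma quot_pi_surj y : exists x, quot_pi x = y.
Proof. by exists (repr (y : {ideal_quot J})); rewrite /quot_pi reprK. Qed.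

End QuotientAlgebra.

(** The quotient is used only through the kernel and the surjectivity of its
    projection, so that its construction is never unfolded. *)
Lemma quotient_algebra (k : fieldType) (A : comAlgType k) (I : set A) :
  is_ideal I -> ~ I 1 ->
  exists (Q : comAlgType k) (p : {lrmorphism A -> Q}),
    (forall x, p x = 0 <-> I x) /\ (forall y, exists x, p x = y).
Proof.
move=> hI h1; exists (quot_alg hI h1), (@quot_pi k A I hI h1 : {lrmorphism _ -> _}).
by split; [exact: quot_pi_eq0|exact: quot_pi_surj].
Qed.

(** * Tensor products of algebras *)

(** Besides the universal property, the two facts that make a tensor product
    computable: it is spanned by the products, and a linear form on the second
    factor extends to a contraction onto the first one. *)
Record tensor_product (k : fieldType) (C D : comAlgType k) := TensorProduct {
  tensor :> comAlgType k;
  tensl : {lrmorphism C -> tensor};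
  tensr : {lrmorphism D -> tensor};
  tensor_span : forall t, exists s : seq (C * D),
    t = \sum_(p <- s) tensl p.1 * tensr p.2;
  tensor_lift : forall (R : comAlgType k)
    (x : {lrmorphism C -> R}) (y : {lrmorphism D -> R}),
    exists h : {lrmorphism tensor -> R},
      (forall c, h (tensl c) = x c) /\ (forall d, h (tensr d) = y d);
  tensor_contract : forall l : {scalar D}, exists L : {linear tensor -> C},
    forall c d, L (tensl c * tensr d) = l d *: c
}.

(** The tensor product is the quotient of an algebra P, which maps onto it, by
    the elements that all contractions kill.  Contractions are then available by
    definition, and it is the universal property that needs a proof. *)
Section TensorQuotient.
Context (k : fieldType) (C D P : comAlgType k).
Context (contract : {scalar D} -> {linear P -> C}) (il : C -> P) (ir : D -> P).

Definition contracts_to_0 : set P := [set p | forall l, contract l p = 0].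

Context (contract1 : forall l, contract l 1 = l 1 *: 1).
Context (contract_l : forall l c, contract l (il c) = l 1 *: c).
Context (contract_r : forall l d, contract l (ir d) = l d *: 1).
Context (contract_ll : forall l c c', contract l (il c * il c') = l 1 *: (c * c')).
Context (contract_rr : forall l d d', contract l (ir d * ir d') = l (d * d') *: 1).
Context (contract_lr : forall l c d, contract l (il c * ir d) = l d *: c).
Context (contractM : forall q p, contracts_to_0 p -> contracts_to_0 (q * p)).
Context (contract_span : forall p, exists s : seq (C * D),
  forall l, contract l p = \sum_(q <- s) l q.2 *: q.1).
Context (contract_lift : forall (R : comAlgType k)
  (x : {lrmorphism C -> R}) (y : {lrmorphism D -> R}),
  exists h : {lrmorphism P -> R}, [/\ forall c, h (il c) = x c,
    forall d, h (ir d) = y d & forall p, contracts_to_0 p -> h p = 0]).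

Fact contracts_to_0_ideal : is_ideal contracts_to_0.
Proof.
split=> [l|p q Jp Jq l|q p Jp]; first exact: linear0.
  by rewrite linearD Jp Jq addr0.
exact: contractM.
Qed.

Fact contracts_to_0_proper : ~ contracts_to_0 1.
Proof.
have [l l1] := exists_functional (oner_neq0 D).
by move=> /(_ l); rewrite contract1 l1 scale1r => /eqP; rewrite oner_eq0.
Qed.

Lemma tensor_product_quotient : inhabited (tensor_product C D).
Proof.
have [T [p [p0 p_surj]]] :=
  quotient_algebra contracts_to_0_ideal contracts_to_0_proper.
have pE q q' : p q = p q' <-> forall l, contract l q = contract l q'.
  split=> [E l|E]; apply/eqP; rewrite -subr_eq0 -linearB.
    by apply/eqP; apply: (p0 (q - q')).1; rewrite linearB /= E subrr.
  by apply/eqP/p0 => l; rewrite linearB /= E subrr.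
have mk (B : comAlgType k) (i : B -> P) :
    (forall l a b c, contract l (i (c *: a + b)) = contract l (c *: i a + i b)) ->
    (forall l a b, contract l (i (a * b)) = contract l (i a * i b)) ->
    (forall l, contract l (i 1) = contract l 1) ->
    {h : {lrmorphism B -> T} | forall b, h b = p (i b)}.
  move=> iD iM i1; pose h b := p (i b).
  have h_lin : linear h.
    by move=> c a b; rewrite /h -linearP; apply/pE => l; rewrite iD.
  have h_mon : monoid_morphism h.
    split; first by rewrite /h -(rmorph1 p); apply/pE => l; rewrite i1.
    by move=> a b; rewrite /h -rmorphM; apply/pE => l; rewrite iM.
  pose h' : {lrmorphism B -> T} := HB.pack h
    (GRing.isLinear.Build k B T *:%R h h_lin)
    (GRing.isMonoidMorphism.Build B T h h_mon).
  by exists h'.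
have [l lE] : {h : {lrmorphism C -> T} | forall b, h b = p (il b)}.
  apply: mk => [l a b c|l a b|l].
  - by rewrite linearP !contract_l scalerDr !scalerA mulrC.
  - by rewrite contract_l contract_ll.
  - by rewrite contract_l contract1.
have [r rE] : {h : {lrmorphism D -> T} | forall b, h b = p (ir b)}.
  apply: mk => [h a b c|h a b|h].
  - by rewrite linearP !contract_r linearP scalerDl scalerA.
  - by rewrite contract_r contract_rr.
  - by rewrite contract_r contract1.
have lrE a b : l a * r b = p (il a * ir b) by rewrite lE rE rmorphM.
have span t : exists s : seq (C * D), t = \sum_(q <- s) l q.1 * r q.2.
  have [q <-] := p_surj t; have [s sE] := contract_span q.
  exists s; under eq_bigr do rewrite lrE.
  rewrite -linear_sum; apply/pE => h; rewrite sE linear_sum.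
  by apply: eq_bigr => i _; rewrite contract_lr.
exists; apply: (@TensorProduct k C D T l r span) => [R x y|h]; last first.
  pose H t := contract h (projT1 (cid (p_surj t))).
  have HE q : H (p q) = contract h q.
    exact: (pE _ _).1 (projT2 (cid (p_surj (p q)))) h.
  have H_lin : linear H.
    move=> c t u; have [q <-] := p_surj t; have [q' <-] := p_surj u.
    by rewrite -linearP !HE linearP.
  pose H' : {linear T -> C} := HB.pack H (GRing.isLinear.Build k T C *:%R H H_lin).
  by exists H' => c d; rewrite -[LHS]/(H _) lrE HE contract_lr.
have [ev [evl evr ev0]] := contract_lift x y.
pose H t := ev (projT1 (cid (p_surj t))).
have HE q : H (p q) = ev q.
  apply/eqP; rewrite -subr_eq0 -rmorphB; apply/eqP/ev0/p0.
  by rewrite linearB /= (projT2 (cid (p_surj (p q)))) subrr.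
have H_lin : linear H.
  move=> c t u; have [q <-] := p_surj t; have [q' <-] := p_surj u.
  by rewrite -linearP !HE linearP.
have H_mon : monoid_morphism H.
  split=> [|t u]; first by rewrite -(rmorph1 p) HE rmorph1.
  have [q <-] := p_surj t; have [q' <-] := p_surj u.
  by rewrite -rmorphM !HE rmorphM.
pose H' : {lrmorphism T -> R} := HB.pack H
  (GRing.isLinear.Build k T R *:%R H H_lin)
  (GRing.isMonoidMorphism.Build T R H H_mon).
by exists H'; split=> [c|d]; rewrite -[LHS]/(H _) ?lE ?rE HE ?evl ?evr.
Qed.

End TensorQuotient.

Section TensorProduct.
Context (k : fieldType) (C D : comAlgType k).

(** Here P is the polynomial ring on the disjoint union of C and D.  A monomial
    has a value f in C and a value g in D, and represents the tensor f (x) g. *)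
Let V : choiceType := Choice.clone (C + D)%type _.
Let P := {malg k[{cmonom V}]}.
Let f (v : V) : C := if v is inl c then c else 1.
Let g (v : V) : D := if v is inr d then d else 1.

Definition contract_fun (l : {scalar D}) : P -> C :=
  mmap (GRing.in_alg C) (fun m => l (monev g m) *: monev f m).

Fact contractU l c m :
  contract_fun l << c *g m >> = c *: (l (monev g m) *: monev f m).
Proof. by rewrite /contract_fun mmapU /= mulr_algl. Qed.

Fact contract_sum l I (r : seq I) (F : I -> P) :
  contract_fun l (\sum_(i <- r) F i) = \sum_(i <- r) contract_fun l (F i).
Proof. exact: raddf_sum. Qed.

Let mulU (c1 c2 : k) (m1 m2 : {cmonom V}) :
  << c1 *g m1 >> * << c2 *g m2 >> = << c1 * c2 *g (mmul m1 m2) >> :> P.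
Proof. exact: fgmulUU. Qed.

Let mono1 := mone : {cmonom V}.

(** Multiplication by a monomial replaces a contraction by another one, whence
    the elements killed by all contractions form an ideal. *)
Fact contractMU (l l' : {scalar D}) c m (p : P) :
  (forall d, l' d = l (monev g m * d)) ->
  contract_fun l (<< c *g m >> * p) = c *: (monev f m * contract_fun l' p).
Proof.
move=> l'E; rewrite (monalgE p) mulr_sumr !contract_sum !mulr_sumr scaler_sumr.
apply: eq_bigr => m' _; rewrite mulU !contractU l'E !monevM.
by rewrite -!scalerAr !scalerA mulrA.
Qed.

Fact contract_linear l : linear (contract_fun l).
Proof.
move=> c p q.
have cpE : c *: p = << c *g mono1 >> * p by rewrite -mul_malgC.
rewrite cpE; apply: etrans (mmapD _ _) _; congr (_ + _).
apply: etrans (@contractMU l l c mono1 p _) _; rewrite ?monalg.mmorph1 ?mul1r //.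
by move=> d; rewrite mul1r.
Qed.

Definition contract l : {linear P -> C} := HB.pack (contract_fun l)
  (GRing.isLinear.Build k P C *:%R (contract_fun l) (contract_linear l)).

Let mul_form (l : {scalar D}) (d : D) : {l' : {scalar D} | forall e, l' e = l (d * e)}.
Proof.
have l_lin : scalar (fun e => l (d * e)).
  by move=> a x y; rewrite mulrDr -scalerAr linearP.
pose l' : {scalar D} := HB.pack (fun e => l (d * e))
  (GRing.isLinear.Build k D k *%R (fun e => l (d * e)) l_lin).
by exists l'.
Qed.

Let contract_var l v : contract l (pvar k v) = l (g v) *: f v.
Proof. by rewrite pvar.unlock [LHS]contractU !monevU scale1r. Qed.

Let contract_var2 l v w :
  contract l (pvar k v * pvar k w) = l (g v * g w) *: (f v * f w).
Proof.
by rewrite pvar.unlock mulU [LHS]contractU !monevM !monevU mulr1 scale1r.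
Qed.

Lemma tensor_product_exists : inhabited (tensor_product C D).
Proof.
apply: (@tensor_product_quotient k C D P contract
  (fun c => pvar k (inl c : V)) (fun d => pvar k (inr d : V))).
- by move=> l; rewrite -[LHS]/(contract_fun l << 1 *g mono1 >>) contractU
    scale1r !monalg.mmorph1.
- by move=> l c; rewrite contract_var.
- by move=> l d; rewrite contract_var.
- by move=> l c c'; rewrite contract_var2 /= mulr1.
- by move=> l d d'; rewrite contract_var2 /= mulr1.
- by move=> l c d; rewrite contract_var2 /= mul1r mulr1.
- move=> q p Jp l; rewrite (monalgE q) mulr_suml [LHS]contract_sum big1 // => m _.
  have [l' l'E] := mul_form l (monev g m).
  by rewrite (contractMU _ _ l'E) [contract_fun _ _]Jp mulr0 scaler0.
- move=> p; exists [seq (p@_m *: monev f m, monev g m) | m <- msupp p] => l.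
  rewrite big_map {1}(monalgE p) [LHS]contract_sum; apply: eq_bigr => m _.
  by rewrite contractU !scalerA mulrC.
move=> R x y.
pose xy (v : V) : R := match v with inl c => x c | inr d => y d end.
pose ev0 : {rmorphism P -> R} := mmap (GRing.in_alg R) (monev xy).
have ev_scalable : scalable ev0.
  by move=> c q; rewrite /ev0 /= mmapZ /= mulr_algl.
pose ev : {lrmorphism P -> R} := HB.pack (ev0 : P -> R)
  (GRing.RMorphism.on ev0) (GRing.isScalable.Build k P R *:%R ev0 ev_scalable).
have ev_var v : ev (pvar k v) = xy v.
  by rewrite pvar.unlock [LHS]mmapU /= scale1r mul1r monevU.
exists ev; split=> [c|d|p Jp]; rewrite ?ev_var //.
(* The morphism defined by x and y kills p as soon as all contractions do: expand
   the second components of the monomials of p in a finite basis, and p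
   becomes a combination of its contractions by the dual basis. *)
have monev_xy m : monev xy m = x (monev f m) * y (monev g m).
  rewrite /monev !rmorph_prod -big_split; apply: eq_bigr => -[c|d] _ /=.
    by rewrite !rmorphXn rmorph1 expr1n mulr1.
  by rewrite !rmorphXn rmorph1 expr1n mul1r.
have evU c m : ev << c *g m >> = c *: (x (monev f m) * y (monev g m)).
  by rewrite [LHS]mmapU /= mulr_algl monev_xy.
pose m (i : 'I_(size (msupp p))) := nth mono1 (msupp p) i.
pose G i := monev g (m i).
have [r [b [h [_ [_ GE _]]]]] := finite_dual_basis G.
rewrite (monalgE p) [LHS]linear_sum (big_nth mono1) big_mkord.
transitivity (\sum_i \sum_(j < r)
    y (b j) * x (p@_(m i) *: (h j (G i) *: monev f (m i)))).
  apply: eq_bigr => i _; apply: etrans (evU _ _) _.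
  rewrite -/(m i) -/(G i) [in LHS]GE linear_sum.
  rewrite mulr_sumr scaler_sumr; apply: eq_bigr => j _.
  by rewrite !linearZ /= -!scalerAr [y _ * _]mulrC.
rewrite exchange_big big1 // => j _; rewrite -mulr_sumr -linear_sum.
suff -> : \sum_i p@_(m i) *: (h j (G i) *: monev f (m i)) = contract (h j) p.
  by rewrite Jp linear0 mulr0.
rewrite [in RHS](monalgE p) [RHS]contract_sum (big_nth mono1) big_mkord.
by apply: eq_bigr => i _; rewrite contractU.
Qed.

End TensorProduct.

(** * Affine group schemes as functors of points *)

(** When p is a surjection onto the functions of a closed subscheme, this says
    that the R-point x lies on it. *)
Definition through (A C R : nzRingType) (p : A -> C) (x : A -> R) :=
  forall a, p a = 0 -> x a = 0.

(** Write the q (g j) in a basis of their span, with dual basis l_t; the sum is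
    then a combination of the images under x of the contractions of the hypothesis
    for l_t.  The basis vectors are combinations of the q (g j), which is how
    they lift to A'. *)
Lemma pairing_eq0 (k : fieldType) (A A' C D R : comAlgType k)
    (p : {lrmorphism A -> C}) (q : {lrmorphism A' -> D})
    (x : {lrmorphism A -> R}) (y : {lrmorphism A' -> R})
    (J : Type) (s : seq J) (f : J -> A) (g : J -> A') :
  through p x -> through q y ->
  (forall l : {scalar D}, \sum_(j <- s) l (q (g j)) *: p (f j) = 0) ->
  \sum_(j <- s) x (f j) * y (g j) = 0.
Proof.
move=> px qy H; rewrite big_tnth.
pose G i := q (g (tnth (in_tuple s) i)).
have [r [b [l [d [_ GE bE]]]]] := finite_dual_basis G.
pose b' t := \sum_i d t i *: g (tnth (in_tuple s) i).
have qb' t : q (b' t) = b t.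
  by rewrite bE linear_sum; apply: eq_bigr => i _; rewrite linearZ.
have gE i : y (g (tnth (in_tuple s) i)) = \sum_t l t (G i) *: y (b' t).
  under eq_bigr do rewrite -linearZ.
  rewrite -linear_sum; apply/eqP; rewrite -subr_eq0 -linearB; apply/eqP/qy.
  rewrite linearB linear_sum /= -/(G i) {1}GE; apply/eqP; rewrite subr_eq0; apply/eqP.
  by apply: eq_bigr => t _; rewrite linearZ /= qb'.
under eq_bigr do rewrite gE mulr_sumr.
rewrite exchange_big big1 // => t _.
transitivity (x (\sum_i l t (G i) *: f (tnth (in_tuple s) i)) * y (b' t)).
  rewrite [x _]linear_sum mulr_suml; apply: eq_bigr => i _.
  by rewrite linearZ /= -scalerAl -scalerAr.
rewrite px ?mul0r // linear_sum /= -[RHS](H (l t)) [RHS]big_tnth.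
by apply: eq_bigr => i _; rewrite linearZ.
Qed.

(** The coordinate ring may be of infinite type here, as that of the
    infinite product represented by k{GG}. *)
Record groupScheme (k : fieldType) := GroupScheme {
  gcoord :> comAlgType k;
  sone : forall R : comAlgType k, {lrmorphism gcoord -> R};
  sinv : forall R : comAlgType k,
    {lrmorphism gcoord -> R} -> {lrmorphism gcoord -> R};
  smul : forall R : comAlgType k,
    {lrmorphism gcoord -> R} -> {lrmorphism gcoord -> R} ->
    {lrmorphism gcoord -> R};
  smulA : forall R, associative (@smul R);
  smul1 : forall R, left_id (@sone R) (@smul R);
  smulV : forall R, left_inverse (@sone R) (@sinv R) (@smul R);
  smul_nat : forall (R S : comAlgType k) (h : {lrmorphism R -> S})
    (x y : {lrmorphism gcoord -> R}),
    h \o smul x y = smul (h \o x : {lrmorphism gcoord -> S})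
                         (h \o y : {lrmorphism gcoord -> S})
                         :> {lrmorphism gcoord -> S}
}.

Section GroupSchemeTheory.
Context (k : fieldType) (H : groupScheme k).
Implicit Types R S : comAlgType k.
Local Notation pt R := {lrmorphism H -> R}.

Lemma smulrV R (x : pt R) : smul x (sinv x) = sone H R.
Proof.
rewrite -[LHS]smul1 -{1}(smulV (sinv x)) -smulA [smul (sinv x) (smul _ _)]smulA.
by rewrite smulV smul1 smulV.
Qed.

Lemma smulr1 R (x : pt R) : smul x (sone H R) = x.
Proof. by rewrite -(smulV x) smulA smulrV smul1. Qed.

Lemma smulIr R (x y z : pt R) : smul x z = smul y z -> x = y.
Proof.
move=> E; rewrite -[x]smulr1 -[y]smulr1 -(smulrV z) !smulA.
by rewrite E.
Qed.

Lemma sone_nat R S (h : {lrmorphism R -> S}) : h \o sone H R = sone H S :> pt S.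
Proof.
by apply: (@smulIr _ _ _ (h \o sone H R)); rewrite -smul_nat !smul1.
Qed.

Lemma sinv_nat R S (h : {lrmorphism R -> S}) (x : pt R) :
  h \o sinv x = sinv (h \o x : pt S) :> pt S.
Proof.
by apply: (@smulIr _ _ _ (h \o x)); rewrite -smul_nat !smulV sone_nat.
Qed.

Definition antipode : pt H := sinv (idfun : pt H).

Lemma sinvE R (x : pt R) f : sinv x f = x (antipode f).
Proof.
have := sinv_nat x (idfun : pt H).
move=> /(congr1 (fun z : pt R => z f)) /= ->.
by congr (sinv _ f); apply: lrmorphism_eq.
Qed.

Definition augmentation (f : H) : k := sone H k^o f.

Lemma augmentationZ c f : augmentation (c *: f) = c * augmentation f.
Proof. by rewrite /augmentation linearZ. Qed.

Lemma augmentationB f g : augmentation (f - g) = augmentation f - augmentation g.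
Proof. by rewrite /augmentation linearB. Qed.

Lemma augmentationC c : augmentation c%:A = c.
Proof. by rewrite augmentationZ /augmentation rmorph1 mulr1. Qed.

Lemma soneE R f : sone H R f = (augmentation f)%:A.
Proof.
have iS : scalable (fun c : k^o => c%:A : R) by move=> c d; rewrite -scalerA.
pose i : {lrmorphism k^o -> R} := HB.pack (fun c : k^o => c%:A : R)
  (GRing.RMorphism.on (GRing.in_alg R)) (GRing.isScalable.Build k k^o R *:%R _ iS).
by rewrite -(sone_nat i).
Qed.

(** The product of the two universal points, with values in the tensor square, is
    the comultiplication; naturality transports its expansion to all pairs of
    points. *)
Lemma comul_exists (f : H) : exists s : seq (H * H), forall R (x y : pt R),
  smul x y f = \sum_(t <- s) x t.1 * y t.2.
Proof.
have [T] := tensor_product_exists H H.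
have [s sE] := tensor_span (smul (tensl T) (tensr T) f).
exists s => R x y; have [h [hl hr]] := tensor_lift T x y.
have hlE : h \o tensl T = x :> pt R by apply: lrmorphism_eq.
have hrE : h \o tensr T = y :> pt R by apply: lrmorphism_eq.
have := smul_nat h (tensl T) (tensr T); rewrite hlE hrE.
move=> /(congr1 (fun z : pt R => z f)) /= <-; rewrite sE linear_sum.
by apply: eq_bigr => t _; rewrite rmorphM /= hl hr.
Qed.

Definition comul (f : H) : seq (H * H) := projT1 (cid (comul_exists f)).

Lemma smulE R (x y : pt R) f : smul x y f = \sum_(t <- comul f) x t.1 * y t.2.
Proof. exact: (projT2 (cid (comul_exists f))). Qed.

(** The span of w is stable under right translations, and a is the matrix of the
    translation, w(xy) = a(y) w(x); its inverse s can be taken to be a(y^-1). *)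
Definition costable r (w : 'I_r -> H) (a s : 'M[H]_r) :=
  a *m s = 1%:M /\ forall (R : comAlgType k) (x y : pt R) i,
    smul x y (w i) = \sum_j x (w j) * y (a i j).

(** Local finiteness of the regular representation: the coefficients of f(xy)
    as a function of x, with respect to a basis of functions of y, span a space of
    translates that contains f. *)
Lemma costable_exists (f : H) : exists r (w : 'I_r -> H) a s,
  costable w a s /\ exists v : 'I_r -> k, f = \sum_i v i *: w i.
Proof.
pose f1 i := (tnth (in_tuple (comul f)) i).1.
pose f2 i := (tnth (in_tuple (comul f)) i).2.
have fE R (x y : pt R) : smul x y f = \sum_i x (f1 i) * y (f2 i).
  by rewrite smulE big_tnth.
have [n [b [l [_ [lb f2E _]]]]] := finite_dual_basis f2.
pose w p := \sum_i l p (f2 i) *: f1 i.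
have fwE R (x y : pt R) : smul x y f = \sum_p x (w p) * y (b p).
  rewrite fE; under eq_bigr do rewrite f2E linear_sum mulr_sumr.
  rewrite exchange_big; apply: eq_bigr => p _.
  rewrite [x _]linear_sum mulr_suml; apply: eq_bigr => i _.
  by rewrite !linearZ /= -scalerAl -scalerAr.
pose al p q := \sum_(t <- comul (b q)) l p t.2 *: t.1.
(* Compare the coefficients of the p-th basis function of z on both sides of
   f((xy)z) = f(x(yz)). *)
have wE R (x y : pt R) p : smul x y (w p) = \sum_q x (w q) * y (al p q).
  have [T] := tensor_product_exists R H.
  have [L LE] := tensor_contract T (l p).
  have E : \sum_q tensl T (smul x y (w q)) * tensr T (b q) =
      \sum_q \sum_(t <- comul (b q)) tensl T (x (w q) * y t.1) * tensr T t.2.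
    pose x' : pt T := tensl T \o x; pose y' : pt T := tensl T \o y.
    transitivity (smul (smul x' y') (tensr T) f).
      by rewrite fwE; apply: eq_bigr => q _; rewrite -smul_nat.
    rewrite -smulA fwE; apply: eq_bigr => q _; rewrite smulE mulr_sumr.
    by apply: eq_bigr => t _; rewrite rmorphM mulrA.
  have := congr1 L E; rewrite !(linear_sum L) /= (bigD1 p) //= big1 => [|q qp].
    rewrite addr0 LE lb eqxx scale1r => ->; apply: eq_bigr => q _.
    rewrite (linear_sum L) [y _]linear_sum mulr_sumr; apply: eq_bigr => t _.
    by rewrite LE linearZ /= scalerAr.
  by rewrite LE lb eq_sym (negPf qp) scale0r.
have [r [c [mu [e [muc wcE cE]]]]] := finite_dual_basis w.
pose a := (\matrix_(s, t) \sum_p \sum_q (e s p * mu t (w q)) *: al p q) : 'M[H]_r.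
have aE R (x y : pt R) s : smul x y (c s) = \sum_t x (c t) * y (a s t).
  transitivity (\sum_p \sum_q \sum_t x (c t) * y ((e s p * mu t (w q)) *: al p q)).
    rewrite cE [LHS]linear_sum; apply: eq_bigr => p _; rewrite linearZ /= wE scaler_sumr.
    apply: eq_bigr => q _; rewrite {1}wcE linear_sum mulr_suml scaler_sumr.
    apply: eq_bigr => t _; rewrite !linearZ /= -scalerAl -scalerAr.
    by rewrite !scalerA.
  under eq_bigr do rewrite exchange_big.
  rewrite exchange_big; apply: eq_bigr => t _; rewrite mxE linear_sum mulr_sumr.
  by apply: eq_bigr => p _; rewrite linear_sum mulr_sumr.
exists r, c, a, (map_mx (antipode) a); split; last first.
  exists (fun t => \sum_p augmentation (b p) * mu t (w p)).
  have := fwE H idfun (sone H H); rewrite smulr1 /= => ->.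
  under [RHS]eq_bigr do rewrite scaler_suml.
  rewrite exchange_big; apply: eq_bigr => p _; rewrite soneE mulr_algr {1}wcE.
  by rewrite scaler_sumr; apply: eq_bigr => t _; rewrite scalerA.
(* As c is linearly independent, c((x y^-1) y) = c(x) can be compared
   coefficientwise. *)
split=> //; apply/matrixP => s u.
have [T] := tensor_product_exists H H.
have E : \sum_t tensr T (c t) * tensl T ((a *m map_mx (antipode) a) s t) =
    tensr T (c s) * tensl T 1.
  transitivity (smul (smul (tensr T) (sinv (tensl T))) (tensl T) (c s)); last first.
    by rewrite -smulA smulV smulr1 rmorph1 mulr1.
  rewrite aE; under [RHS]eq_bigr do rewrite aE mulr_suml.
  rewrite exchange_big; apply: eq_bigr => t _; rewrite mxE linear_sum mulr_sumr.
  apply: eq_bigr => v _; rewrite rmorphM [map_mx _ _ _ _]mxE sinvE.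
  by rewrite /= [X in _ * X]mulrC mulrA.
have [L LE] := tensor_contract T (mu u).
have := congr1 L E; rewrite (linear_sum L) /= [tensr T _ * _]mulrC LE muc.
rewrite (bigD1 u) //= big1 => [|t tu].
  rewrite addr0 [tensr T _ * _]mulrC LE muc eqxx scale1r => ->.
  by rewrite [RHS]mxE eq_sym scaler_nat.
by rewrite [tensr T _ * _]mulrC LE muc eq_sym (negPf tu) scale0r.
Qed.

End GroupSchemeTheory.

(** * Matrices *)

(** Both sides become equal after multiplication by det A det B. *)
Lemma adjM_regular (R : comNzRingType) n (A B : 'M[R]_n) :
  GRing.lreg (\det A) -> GRing.lreg (\det B) ->
  \adj (A *m B) = \adj B *m \adj A.
Proof.
move=> rA rB.
have E : \det A *: (\det B *: \adj (A *m B)) = \det A *: (\det B *: (\adj B *m \adj A)).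
  transitivity (\adj B *m \adj A *m (A *m B) *m \adj (A *m B)).
    rewrite -!mulmxA [\adj A *m _]mulmxA mul_adj_mx mul_scalar_mx -scalemxAr.
    by rewrite mulmxA mul_adj_mx mul_scalar_mx.
  by rewrite -!mulmxA [A *m (B *m _)]mulmxA mul_mx_adj mul_mx_scalar
    det_mulmx -scalemxAr scalerA.
apply/matrixP => i j; apply: rB; apply: rA.
by have := congr1 (fun M : 'M_n => M i j) E; rewrite !mxE.
Qed.

(** The identity is polynomial in the entries: replace A and B by the matrices
    X + A and X + B over R[X], whose determinants are monic, hence regular, and
    evaluate at X = 0. *)
Lemma adjM (R : comNzRingType) n (A B : 'M[R]_n) : \adj (A *m B) = \adj B *m \adj A.
Proof.
have reg (M : 'M[R]_n) : GRing.lreg (\det (char_poly_mx M)).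
  exact/monic_lreg/char_poly_monic.
have ev (M : 'M[R]_n) : map_mx (horner_eval 0) (char_poly_mx (- M)) = M.
  apply/matrixP => i j; rewrite !mxE /horner_eval !hornerE hornerMn hornerX.
  by rewrite mul0rn sub0r opprK.
have := congr1 (map_mx (horner_eval 0)) (adjM_regular (reg (- A)) (reg (- B))).
by rewrite map_mxM !map_mx_adj map_mxM !ev.
Qed.

(** The rows of K and the row u factor through t coordinates, namely through the
    matrix E S; Cramer's rule expresses u through the rows of K up to the
    factor det (K F).  The coefficients are polynomials in the entries of K, u and
    F alone, which lets the identity descend to the subring where these
    entries lie. *)
Lemma cramer_factor (R : comNzRingType) t r (K : 'M[R]_(t, r)) (u : 'rV_r)
    (A S : 'M_r) (F : 'M_(r, t)) (E : 'M_(t, r)) :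
  A *m S = 1%:M -> K *m A = K *m A *m F *m E -> u *m A = u *m A *m F *m E ->
  \det (K *m F) *: u = u *m F *m \adj (K *m F) *m K.
Proof.
move=> AS KA uA.
have := congr1 (mulmx^~ S) KA; have := congr1 (mulmx^~ S) uA.
rewrite -![_ *m A *m S]mulmxA AS !mulmx1 -![_ *m E *m S]mulmxA.
move: (K *m A *m F) (u *m A *m F) (E *m S) => d x N -> -> {KA uA}.
rewrite -!mulmxA [N *m (F *m _)]mulmxA adjM det_mulmx.
rewrite [N *m F *m (_ *m _)]mulmxA [N *m F *m (_ *m _)]mulmxA mul_mx_adj.
rewrite mul_scalar_mx -scalemxAl -scalemxAr.
rewrite [\adj d *m _]mulmxA mul_adj_mx mul_scalar_mx -!scalemxAr scalerA.
by rewrite mulrC.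
Qed.

Lemma maximal_free_rows (k : fieldType) r (P : set 'rV[k]_r) :
  exists t (e : 'M[k]_(t, r)),
    [/\ forall i, P (row i e), row_free e & forall v, P v -> (v <= e)%MS].
Proof.
pose Q t := `[< exists e : 'M[k]_(t, r), (forall i, P (row i e)) /\ row_free e >].
have Q0 : exists t, Q t.
  by exists 0%N; apply/asboolP; exists 0; split=> [[]//|]; rewrite /row_free mxrank0.
have Qr t : Q t -> (t <= r)%N.
  by move=> /asboolP[e [_ /eqP <-]]; exact: rank_leq_col.
case: (ex_maxnP Q0 Qr) => t /asboolP[e [Pe fe]] tmax.
exists t, e; split=> // v Pv; apply: contrapT => /negP ve.
suff : Q t.+1 by move=> /tmax; rewrite ltnn.
rewrite -addn1; apply/asboolP; exists (col_mx e v); split=> [i|].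
  case: (split_ordP i) => j ->; first by rewrite rowKu.
  by rewrite rowKd row_id // ord1.
have : (\rank e < \rank (col_mx e v))%N.
  by rewrite -addsmxE rank_ltmx // ltmxE addsmxSl addsmx_sub submx_refl.
move: (fe); rewrite /row_free => /eqP-> lt; rewrite /row_free eqn_leq rank_leq_row /=.
by rewrite [X in (X <= _)%N]addn1.
Qed.

(** * Subgroups with the same kernel and the same image *)

Lemma split_lshift m n (j : 'I_m) : split (lshift n j) = inl j.
Proof. exact: (unsplitK (inl j)). Qed.

Lemma split_rshift m n (j : 'I_n) : split (rshift m j) = inr j.
Proof. exact: (unsplitK (inr j)). Qed.

Section CostableFamilies.
Context (k : fieldType) (H : groupScheme k).

Definition cat_fam r1 r2 (w1 : 'I_r1 -> H) (w2 : 'I_r2 -> H) (i : 'I_(r1 + r2)) : H :=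
  match split i with inl j => w1 j | inr j => w2 j end.

Lemma cat_famL r1 r2 (w1 : 'I_r1 -> H) (w2 : 'I_r2 -> H) j :
  cat_fam w1 w2 (lshift r2 j) = w1 j.
Proof. by rewrite /cat_fam split_lshift. Qed.

Lemma cat_famR r1 r2 (w1 : 'I_r1 -> H) (w2 : 'I_r2 -> H) j :
  cat_fam w1 w2 (rshift r1 j) = w2 j.
Proof. by rewrite /cat_fam split_rshift. Qed.

Lemma costable_cat r1 r2 (w1 : 'I_r1 -> H) (w2 : 'I_r2 -> H) a1 s1 a2 s2 :
  costable w1 a1 s1 -> costable w2 a2 s2 ->
  costable (cat_fam w1 w2) (block_mx a1 0 0 a2) (block_mx s1 0 0 s2).
Proof.
move=> [as1 E1] [as2 E2]; split=> [|R x y i].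
  by rewrite mulmx_block !mulmx0 !mul0mx !addr0 !add0r as1 as2 -scalar_mx_block.
rewrite big_split_ord /=; case: (split_ordP i) => j ->.
  rewrite cat_famL E1 [X in _ + X]big1 ?addr0 => [|l _]; last first.
    by rewrite block_mxEur mxE rmorph0 mulr0.
  by apply: eq_bigr => l _; rewrite cat_famL block_mxEul.
rewrite cat_famR E2 [X in X + _]big1 ?add0r => [|l _]; last first.
  by rewrite block_mxEdl mxE rmorph0 mulr0.
by apply: eq_bigr => l _; rewrite cat_famR block_mxEdr.
Qed.

Lemma costable_seq (cs : seq H) : exists r (w : 'I_r -> H) a s, costable w a s /\
  forall c, c \in cs -> exists v : 'I_r -> k, c = \sum_i v i *: w i.
Proof.
elim: cs => [|c cs [r2 [w2 [a2 [s2 [st2 sp2]]]]]].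
  exists 0%N, (fun=> 0), 0, 0; split=> //; split=> [|R x y []//].
  by apply/matrixP => -[].
have [r1 [w1 [a1 [s1 [st1 [v vE]]]]]] := costable_exists c.
exists (r1 + r2)%N, (cat_fam w1 w2), (block_mx a1 0 0 a2), (block_mx s1 0 0 s2).
split=> [|d]; first exact: costable_cat.
rewrite inE => /predU1P[->|/sp2[u ->]].
  exists (fun i => if split i is inl j then v j else 0).
  rewrite vE big_split_ord /= [X in _ + X]big1 ?addr0 => [|j _]; last first.
    by rewrite split_rshift scale0r.
  by apply: eq_bigr => j _; rewrite cat_famL split_lshift.
exists (fun i => if split i is inr j then u j else 0).
rewrite big_split_ord /= [X in X + _]big1 ?add0r => [|j _]; last first.
  by rewrite split_lshift scale0r.
by apply: eq_bigr => j _; rewrite cat_famR split_rshift.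
Qed.

End CostableFamilies.

(** Linear forms separate the points of D, so a row all of whose images lie in the
    span of e lies in the span of e over D; pinvmx e projects onto it. *)
Lemma map_mx_submx_functional (k : fieldType) (D : comAlgType k) r t
    (M : 'rV[D]_r) (e : 'M[k]_(t, r)) :
  (forall l : {scalar D}, (map_mx l M <= e)%MS) ->
  M = M *m map_mx (GRing.in_alg D) (pinvmx e) *m map_mx (GRing.in_alg D) e.
Proof.
move=> le; rewrite -mulmxA -map_mxM /=; apply/rowP => j.
apply/eqP; rewrite -subr_eq0; apply/eqP/functionals_separate => l.
rewrite linearB /= [X in _ - X](_ : _ = (map_mx l M *m (pinvmx e *m e)) 0 j).
  by rewrite mulmxA mulmxKpV // mxE subrr.
rewrite !mxE linear_sum; apply: eq_bigr => i _.
by rewrite [map_mx _ _ i j]mxE mulr_algr linearZ /= mulrC [map_mx _ _ _ i]mxE.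
Qed.

(** On functions, iota is a morphism of groups from H to H0, and p and q are the
    restrictions to a larger and to a smaller subgroup of H.  That their kernels
    under this morphism are the same means that the ideal of the smaller subgroup
    is contained in the one generated by the ideal of the larger subgroup and the
    augmentation ideal of H0. *)
Section EqualSubgroups.
Context (k : fieldType) (H H0 : groupScheme k) (iota : {lrmorphism H0 -> H}).
Context (iota_hom : forall (R : comAlgType k) (x y : {lrmorphism H -> R}) b,
  smul x y (iota b) = smul (x \o iota : {lrmorphism H0 -> R})
    (y \o iota : {lrmorphism H0 -> R}) b).
Context (C D : comAlgType k) (p : {lrmorphism H -> C}) (q : {lrmorphism H -> D}).
Context (p_le_q : through p q).
Context (p_mul : forall (R : comAlgType k) (x y : {lrmorphism H -> R}),
  through p x -> through p y -> through p (smul x y)).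
Context (p_inv : forall (R : comAlgType k) (x : {lrmorphism H -> R}),
  through p x -> through p (sinv x)).
Context (q_mul : forall (R : comAlgType k) (x y : {lrmorphism H -> R}),
  through q x -> through q y -> through q (smul x y)).
Context (q_inv : forall (R : comAlgType k) (x : {lrmorphism H -> R}),
  through q x -> through q (sinv x)).
Context (same_image : through (q \o iota) (p \o iota)).
Context (same_kernel : forall f, q f = 0 -> exists s : seq (H0 * H),
  (forall t, t \in s -> augmentation (iota t.1) = 0) /\
  p f = \sum_(t <- s) p (iota t.1 * t.2)).

Context (eps : {rmorphism H0 -> k}).
Context (epsE : forall b, eps b = augmentation (iota b)).

Lemma epsZ c b : eps (c *: b) = c * eps b.
Proof. by rewrite !epsE linearZ augmentationZ. Qed.

Lemma smul_iota (R : comAlgType k) (x y : {lrmorphism H -> R}) b :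
  smul x y (iota b) = \sum_(t <- comul b) x (iota t.1) * y (iota t.2).
Proof. by rewrite iota_hom smulE. Qed.

(** This is b = (e (x) id) (Delta b), for the left unit law. *)
Lemma iota_eps b : iota b = \sum_(t <- comul b) eps t.1 *: iota t.2.
Proof.
have := smul_iota (sone H H) idfun b; rewrite smul1 /= => ->.
by apply: eq_bigr => t _; rewrite epsE soneE mulr_algl.
Qed.

(** The coefficients are functions on the target of iota, so that multiplying by
    them is compatible with [same_image]. *)
Definition is_relation (E : nzRingType) (pi : H -> E) r (w : 'I_r -> H)
  (u : 'rV[H0]_r) : Prop := pi (\sum_i iota (u 0 i) * w i) = 0.

(** Evaluate the relation at xy and contract the functions of y by l: what remains
    is a relation between the w (x), and its value at the identity is l
    applied to the row u a, because u(1 y) a(y) = (u a)(y). *)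
Lemma relation_twist (E : comAlgType k) (pi : {lrmorphism H -> E})
    r (w : 'I_r -> H) a s (u : 'rV[H0]_r) (l : {scalar D}) :
  (forall (R : comAlgType k) (x y : {lrmorphism H -> R}),
    through pi x -> through q y -> through pi (smul x y)) ->
  costable w a s -> is_relation pi w u ->
  exists v : 'rV[H0]_r, is_relation pi w v /\
    forall j, eps (v 0 j) = l (q (\sum_i iota (u 0 i) * a i j)).
Proof.
move=> cl [_ wa] piu.
have [T] := tensor_product_exists E D; have [L LE] := tensor_contract T l.
pose x : {lrmorphism H -> T} := tensl T \o pi.
pose y : {lrmorphism H -> T} := tensr T \o q.
pose v : 'rV[H0]_r := \row_j \sum_i \sum_(t <- comul (u 0 i))
  l (q (iota t.2 * a i j)) *: t.1.
exists v; split=> [|j]; last first.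
  rewrite mxE [LHS]raddf_sum [q _]linear_sum [RHS]linear_sum /=; apply: eq_bigr => i _.
  rewrite [in RHS]iota_eps mulr_suml [q _]linear_sum [RHS]linear_sum [LHS]raddf_sum /=.
  apply: eq_bigr => t _.
  by rewrite epsZ -scalerAl !linearZ /= mulrC.
have : smul x y (\sum_i iota (u 0 i) * w i) = 0.
  apply: cl piu => [f pif|f qf].
    by rewrite /x /= pif rmorph0.
  by rewrite /y /= qf rmorph0.
have -> : smul x y (\sum_i iota (u 0 i) * w i) =
    \sum_i \sum_j \sum_(t <- comul (u 0 i))
      tensl T (pi (iota t.1 * w j)) * tensr T (q (iota t.2 * a i j)).
  rewrite linear_sum; apply: eq_bigr => i _; rewrite rmorphM /= smul_iota wa.
  rewrite mulr_sumr; apply: eq_bigr => j _; rewrite mulr_suml; apply: eq_bigr => t _.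
  by rewrite /x /y /= !rmorphM /= mulrACA.
move=> /(congr1 L); rewrite linear0 => E0; rewrite /is_relation -[RHS]E0.
rewrite [LHS]linear_sum [RHS](linear_sum L) /=.
under [RHS]eq_bigr do rewrite (linear_sum L).
rewrite [RHS]exchange_big; apply: eq_bigr => j _.
rewrite mxE (linear_sum iota) /= mulr_suml (linear_sum pi) /=; apply: eq_bigr => i _.
rewrite (linear_sum iota) /= mulr_suml (linear_sum pi) /= (linear_sum L).
by apply: eq_bigr => t _; rewrite LE linearZ /= -scalerAl linearZ.
Qed.

Lemma p_mulq (R : comAlgType k) (x y : {lrmorphism H -> R}) :
  through p x -> through q y -> through p (smul x y).
Proof. by move=> px qy; apply: p_mul => // f /p_le_q/qy. Qed.

(** The family w is enlarged so that every value at the identity of a relation for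
    q on w is the value of a relation for p.  Let e be a basis of the values at
    the identity of the relations for p, lifted to relations kk.  By
    [relation_twist], over D both kk and any relation u for q become, after
    multiplication by a, combinations of the rows of e; so
    [cramer_factor] writes det (kk F) u as a combination of the rows of kk, first
    over D, and then modulo the larger subgroup since all coefficients come from
    H0.  As F is a right inverse of e, the determinant is 1 at the
    identity. *)
Lemma annihilator r (w : 'I_r -> H) a s : costable w a s ->
  exists d : H0, eps d = 1 /\ forall u : 'rV[H0]_r, is_relation q w u ->
    p (iota d * \sum_i iota (u 0 i) * w i) = 0.
Proof.
move=> st.
have [t' [e' [Pe' _ le_e']]] := maximal_free_rows
  [set v | exists u, is_relation q w u /\ v = map_mx eps u].
have [u' u'P] := choice Pe'.
have [bc bcP] := choice (fun l => same_kernel (u'P l).1).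
pose cs := [seq t.2 | l <- enum 'I_t', t <- bc l].
have [r2 [w2 [a2 [s2 [st2 sp2]]]]] := costable_seq cs.
have /choice[cf cfP] : forall c, exists v : 'I_r2 -> k,
    c \in cs -> c = \sum_i v i *: w2 i.
  move=> c.
  have [/sp2[v vE]|] := boolP (c \in cs); first by exists v.
  by exists (fun=> 0).
have st' := costable_cat st st2.
set w' := cat_fam w w2 in st'; set a' := block_mx a _ _ _ in st'.
set s' := block_mx s _ _ _ in st'.
have row_mx_sum (u1 : 'rV[H0]_r) (u2 : 'rV[H0]_r2) :
    \sum_i iota (row_mx u1 u2 0 i) * w' i =
    \sum_i iota (u1 0 i) * w i + \sum_i iota (u2 0 i) * w2 i.
  rewrite big_split_ord /=; congr (_ + _); apply: eq_bigr => i _.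
    by rewrite row_mxEl /w' cat_famL.
  by rewrite row_mxEr /w' cat_famR.
have [t [e [Pe fe le_e]]] := maximal_free_rows
  [set v | exists u, is_relation p w' u /\ v = map_mx eps u].
have [kf kfP] := choice Pe.
pose kk : 'M[H0]_(t, r + r2) := \matrix_i kf i.
have kkE : map_mx eps kk = e.
  by apply/row_matrixP => i; rewrite -map_row rowK (kfP i).2.
(* By the hypothesis on the kernels, the function given by a relation for q is,
   modulo the ideal of the larger subgroup, a combination of w2 with coefficients
   that vanish at the identity; subtracting it gives a relation for p with the same
   value at the identity. *)
have le_pad (v : 'rV_r) : (v <= e')%MS -> (row_mx v 0 <= e)%MS.
  have pad_e' : (row_mx e' (0 : 'M_(t', r2)) <= e)%MS.
    apply/row_subP => l; apply: le_e.
    exists (row_mx (u' l) (\row_j - \sum_(t <- bc l) cf t.2 j *: t.1)); split.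
      rewrite /is_relation row_mx_sum linearD /= (bcP l).2 -[RHS](subrr
        (\sum_(t <- bc l) p (iota t.1 * t.2))); congr (_ + _).
      rewrite -linear_sum -linearN; congr (p _); rewrite -sumrN.
      transitivity (- \sum_(t <- bc l) \sum_j cf t.2 j *: (iota t.1 * w2 j)).
        rewrite exchange_big -sumrN; apply: eq_bigr => j _.
        rewrite mxE linearN /= mulNr linear_sum /= mulr_suml; congr (- _).
        by apply: eq_bigr => c _; rewrite linearZ /= scalerAl.
      rewrite -sumrN !big_seq; apply: eq_bigr => c cl; congr (- _).
      have cc : c.2 \in cs.
        by apply/allpairsPdep; exists l, c; split=> //; rewrite mem_enum.
      rewrite [in RHS](cfP _ cc) mulr_sumr.
      by apply: eq_bigr => j _; rewrite scalerAr.
    rewrite map_row_mx row_row_mx -(u'P l).2 row0; congr row_mx.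
    apply/rowP => j; rewrite !mxE rmorphN rmorph_sum big_seq big1 ?oppr0 // => c cl.
    by rewrite epsZ epsE (bcP l).1 ?mulr0.
  move=> /submxP[x ->].
  have -> : row_mx (x *m e') (0 : 'rV_r2) = x *m row_mx e' 0.
    by rewrite mul_mx_row mulmx0.
  exact: mulmx_sub.
pose qi : {rmorphism H0 -> D} := q \o iota.
pose F := map_mx (GRing.in_alg H0) (pinvmx e).
have F_D : map_mx qi F = map_mx (GRing.in_alg D) (pinvmx e).
  apply/matrixP => i j; rewrite !mxE /qi /=.
  by rewrite linearZ /= linearZ /= !rmorph1.
(* The row u a over D, contracted by l, is the value at the identity of the
   relation v. *)
have twist_row (u : 'rV[H0]_(r + r2)) (l : {scalar D}) (v : 'rV[H0]_(r + r2)) :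
    (forall j, eps (v 0 j) = l (q (\sum_i iota (u 0 i) * a' i j))) ->
    map_mx l (map_mx qi u *m map_mx q a') = map_mx eps v.
  move=> vE; apply/rowP => j; rewrite !mxE vE (linear_sum q); congr (l _).
  by apply: eq_bigr => i _; rewrite rmorphM !mxE.
have KA : map_mx qi kk *m map_mx q a' =
    map_mx qi kk *m map_mx q a' *m map_mx qi F *m map_mx (GRing.in_alg D) e.
  apply/row_matrixP => i; rewrite F_D !row_mul -map_row rowK.
  apply: map_mx_submx_functional => l; apply: le_e.
  have [v [rv vE]] := relation_twist l p_mulq st' (kfP i).1.
  by exists v; split=> //; apply: twist_row.
pose d := \det (kk *m F); exists d; split.
  rewrite -det_map_mx map_mxM kkE.
  have -> : map_mx eps F = pinvmx e.
    by apply/matrixP => i j; rewrite !mxE epsZ rmorph1 mulr1.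
  by rewrite mulmxVp // det1.
move=> u rel_u; pose pu : 'rV[H0]_(r + r2) := row_mx u 0.
have uA : map_mx qi pu *m map_mx q a' =
    map_mx qi pu *m map_mx q a' *m map_mx qi F *m map_mx (GRing.in_alg D) e.
  rewrite F_D; apply: map_mx_submx_functional => l.
  have [v [rv vE]] := relation_twist l q_mul st rel_u.
  rewrite [map_mx l _](_ : _ = row_mx (map_mx eps v) 0).
    by apply: le_pad; apply: le_e'; exists v.
  have -> : map_mx eps v = map_mx l (map_mx qi u *m map_mx q a).
    apply/rowP => j; rewrite !mxE vE (linear_sum q); congr (l _).
    by apply: eq_bigr => i _; rewrite rmorphM !mxE.
  rewrite map_row_mx map_block_mx !map_mx0 mul_row_block !mul0mx mulmx0.
  by rewrite !addr0 map_row_mx map_mx0.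
have aS : map_mx q a' *m map_mx q s' = 1%:M by rewrite -map_mxM st'.1 map_mx1.
pose y := pu *m F *m \adj (kk *m F).
(* The identity of Cramer holds over D between elements of H0, where being zero on
   the smaller and on the larger subgroup is the same. *)
have yE j : p (iota (d * pu 0 j)) = p (iota ((y *m kk) 0 j)).
  apply/eqP; rewrite -subr_eq0 -!linearB; apply/eqP.
  apply: (same_image (a := d * pu 0 j - (y *m kk) 0 j)).
  have dpu : (d *: pu) 0 j = d * pu 0 j by rewrite mxE.
  have := cramer_factor aS KA uA.
  rewrite -!(map_mxM qi) det_map_mx -map_mx_adj -!(map_mxM qi) -map_mxZ.
  move=> /rowP/(_ j); rewrite [LHS]mxE [RHS]mxE dpu => E.
  by rewrite -[LHS]/(qi _) rmorphB E subrr.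
have -> : \sum_i iota (u 0 i) * w i = \sum_i iota (pu 0 i) * w' i.
  rewrite row_mx_sum [X in _ + X]big1 ?addr0 // => i _.
  by rewrite mxE rmorph0 mul0r.
rewrite mulr_sumr linear_sum.
transitivity (\sum_l p (iota (y 0 l)) * p (\sum_i iota (kk l i) * w' i)).
  under [RHS]eq_bigr do rewrite (linear_sum p) mulr_sumr.
  rewrite exchange_big; apply: eq_bigr => i _ /=.
  rewrite mulrA rmorphM -[iota _ * _]rmorphM /= yE mxE !linear_sum mulr_suml.
  by apply: eq_bigr => l _; rewrite !rmorphM mulrA.
rewrite big1 // => l _.
have := (kfP l).1; rewrite /is_relation => rl.
by under eq_bigr do rewrite mxE; rewrite rl mulr0.
Qed.

(** With d from [annihilator] for a family containing f, one has
    d(x) f(xz) = 0 for x in the larger and z in the smaller subgroup, because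
    the translates f(xz) are again in the span of w and vanish on the smaller
    subgroup.  For x and z replaced by xy and y^-1 this reads d(xy) f(x) = 0. *)
Theorem equal_of_same_kernel_image : through q p.
Proof.
move=> f qf.
have [r [w [a [s [st [v fE]]]]]] := costable_exists f.
have [d [d1 dP]] := annihilator st.
pose ga j := \sum_i v i *: a i j.
have smul_f (R : comAlgType k) (x z : {lrmorphism H -> R}) :
    smul x z f = \sum_j x (w j) * z (ga j).
  rewrite {1}fE linear_sum; under eq_bigr do rewrite linearZ /= st.2 scaler_sumr.
  rewrite exchange_big; apply: eq_bigr => j _; rewrite (linear_sum z) mulr_sumr.
  by apply: eq_bigr => i _; rewrite linearZ /= scalerAr.
have kill1 (R : comAlgType k) (x z : {lrmorphism H -> R}) :
    through p x -> through q z -> x (iota d) * smul x z f = 0.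
  move=> px qz; rewrite smul_f mulr_sumr.
  under eq_bigr do rewrite mulrA -rmorphM.
  apply: (pairing_eq0 px qz) => l.
  pose u : 'rV[H0]_r := \row_j (l (q (ga j)))%:A.
  have uE : \sum_i iota (u 0 i) * w i = \sum_j l (q (ga j)) *: w j.
    by apply: eq_bigr => j _; rewrite mxE linearZ /= rmorph1 mulr_algl.
  have := dP u; rewrite uE => dP'; rewrite -[RHS]dP'.
    rewrite mulr_sumr linear_sum; apply: eq_bigr => j _.
    by rewrite -scalerAr linearZ.
  rewrite /is_relation uE.
  have [T] := tensor_product_exists D D; have [L LE] := tensor_contract T l.
  have : smul (tensl T \o q : {lrmorphism H -> T})
      (tensr T \o q : {lrmorphism H -> T}) f = 0.
    by apply: q_mul qf => g /= ->; rewrite rmorph0.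
  rewrite smul_f => /(congr1 L); rewrite linear0 => <-.
  rewrite (linear_sum L) linear_sum; apply: eq_bigr => j _.
  by rewrite LE linearZ.
have kill2 (l : {scalar D}) :
    \sum_(t <- comul d) l (q (iota t.2)) *: p (iota t.1 * f) = 0.
  have [T] := tensor_product_exists C D; have [L LE] := tensor_contract T l.
  pose x : {lrmorphism H -> T} := tensl T \o p.
  pose y : {lrmorphism H -> T} := tensr T \o q.
  have px : through p x by move=> g pg; rewrite /x /= pg rmorph0.
  have qy : through q y by move=> g qg; rewrite /y /= qg rmorph0.
  have := kill1 _ (smul x y) (sinv y) (p_mulq px qy) (q_inv qy).
  rewrite -smulA smulrV smulr1 smul_iota mulr_suml => /(congr1 L).
  rewrite linear0 => E0; rewrite -[RHS]E0 (linear_sum L); apply: eq_bigr => t _.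
  by rewrite /x /y /= mulrAC -rmorphM -rmorphM LE.
(* The identity d(xy) f(x) = 0 has been proved for y in the smaller subgroup, but
   as a function of y it only involves functions from H0, which vanish on both
   subgroups simultaneously; so y = x^-1 is allowed. *)
have pp : through p p by [].
pose ip : {lrmorphism H0 -> C} := sinv p \o iota.
have qip : through (q \o iota) ip by move=> b /same_image; apply: p_inv.
have := @pairing_eq0 k H H0 C D C p (q \o iota : {lrmorphism H0 -> D}) p ip _
  (comul d) (fun t => iota t.1 * f) (fun t => t.2) pp qip kill2.
under eq_bigr do rewrite rmorphM mulrAC.
rewrite -mulr_suml -(smul_iota p (sinv p)) smulrV soneE -epsE d1 scale1r mul1r.
by [].
Qed.

End EqualSubgroups.

(** * The group structure of the twisted products *)

(** R with scalars acting through tau; the semilinear maps of the twisted products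
    are morphisms of algebras into such rings. *)
Definition twisted (k : fieldType) (tau : {rmorphism k -> k})
  (R : comAlgType k) : Type := R.

Section Twisted.
Context (k : fieldType) (tau : {rmorphism k -> k}).
Local Notation twisted := (twisted tau).

Section TwistedAlgebra.
Context (R : comAlgType k).
HB.instance Definition _ := GRing.ComNzRing.on (twisted R).

Definition twisted_scale (c : k) (x : twisted R) : twisted R := (tau c *: (x : R)).

Fact twisted_scaleA a b x :
  twisted_scale a (twisted_scale b x) = twisted_scale (a * b) x.
Proof. by rewrite /twisted_scale scalerA rmorphM. Qed.
Fact twisted_scale1 : left_id 1 twisted_scale.
Proof. by move=> x; rewrite /twisted_scale rmorph1 scale1r. Qed.
Fact twisted_scaleDr : right_distributive twisted_scale +%R.
Proof. by move=> a x y; rewrite /twisted_scale [LHS]scalerDr. Qed.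
Fact twisted_scaleDl x : {morph twisted_scale^~ x : a b / a + b}.
Proof. by move=> a b; rewrite /twisted_scale rmorphD scalerDl. Qed.
HB.instance Definition _ := GRing.Zmodule_isLmodule.Build k (twisted R)
  twisted_scaleA twisted_scale1 twisted_scaleDr twisted_scaleDl.
Fact twisted_scaleAl a (x y : twisted R) : a *: (x * y) = (a *: x) * y.
Proof. exact: scalerAl. Qed.
HB.instance Definition _ :=
  GRing.Lmodule_isLalgebra.Build k (twisted R) twisted_scaleAl.
HB.instance Definition _ := GRing.Lalgebra_isComAlgebra.Build k (twisted R).

End TwistedAlgebra.

Lemma twisted_lrmorphism (A R : comAlgType k) (f : {rmorphism A -> R}) :
  (forall c, f c%:A = (tau c)%:A) ->
  {g : {lrmorphism A -> twisted R} | forall a, g a = f a}.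
Proof.
move=> fC.
have fZ : scalable (f : A -> twisted R).
  by move=> c a; rewrite -mulr_algl rmorphM fC mulr_algl.
pose g : {lrmorphism A -> twisted R} := HB.pack (f : A -> twisted R)
  (GRing.RMorphism.on f)
  (GRing.isScalable.Build k A (twisted R) *:%R (f : A -> twisted R) fZ).
by exists g.
Qed.

End Twisted.

Definition algGroup_scheme (k : fieldType) (G : algGroup k) : groupScheme k.
Proof.
apply: (@GroupScheme k G (gone G) (@ginv k G) (@gmul k G)).
- exact: gmulA.
- exact: gmul1.
- exact: gmulV.
- by move=> R S h x y; apply: lrmorphism_eq; apply: gmul_nat.
Defined.

Fact sigma_iter (k : fieldType) (sigma : {rmorphism k -> k}) n :
  {f : {rmorphism k -> k} | forall c, f c = iter n sigma c}.
Proof.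
elim: n => [|n [f fE]]; first by exists idfun.
by exists (sigma \o f) => c /=; rewrite fE.
Qed.

(** A point of the twisted product with values in R is a family of points of GG,
    the j-th one with values in R twisted by sigma^(e j); they are multiplied
    componentwise. *)
Section TwistTensorGroup.
Context (k : fieldType) (sigma : {rmorphism k -> k}) (G : algGroup k).
Context (J : choiceType) (e : J -> nat).

Local Notation T := (twist_tensor sigma G e).
Local Notation sg j := (sval (sigma_iter sigma (e j))).
Local Notation tw j R := (twisted (sg j) R).
Local Notation GG := (algGroup_scheme G).

Implicit Types R S : comAlgType k.

Fact component_exists R (x : {lrmorphism T -> R}) j :
  {f : {lrmorphism G -> tw j R} | forall a, f a = x (tin sigma e j a)}.
Proof.
apply: (@twisted_lrmorphism k (sg j) G R (x \o tin sigma e j)) => c /=.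
rewrite tinC (svalP (sigma_iter sigma (e j))); exact: rmorph_alg.
Qed.

Definition component R (x : {lrmorphism T -> R}) j : {lrmorphism G -> tw j R} :=
  sval (component_exists x j).

Lemma componentE R (x : {lrmorphism T -> R}) j a :
  component x j a = x (tin sigma e j a).
Proof. exact: (svalP (component_exists x j)). Qed.

Fact of_components_exists R (f : forall j, {lrmorphism G -> tw j R}) :
  {x : {lrmorphism T -> R} | forall j a, x (tin sigma e j a) = f j a}.
Proof.
pose phi j : {rmorphism G -> R} := (f j : {rmorphism G -> tw j R}).
have phi_semi : twist_semilinear sigma e (GRing.in_alg R) phi.
  move=> j c; rewrite -(svalP (sigma_iter sigma (e j)) c).
  exact: (rmorph_alg (f j) c).
exists (tlift_alg phi_semi) => j a; exact: (tlift_in phi_semi).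
Qed.

Definition of_components R (f : forall j, {lrmorphism G -> tw j R}) :
  {lrmorphism T -> R} := sval (of_components_exists f).

Lemma of_componentsE R (f : forall j, {lrmorphism G -> tw j R}) j a :
  of_components f (tin sigma e j a) = f j a.
Proof. exact: (svalP (of_components_exists f)). Qed.

Lemma component_of R (f : forall j, {lrmorphism G -> tw j R}) j :
  component (of_components f) j = f j.
Proof. by apply: lrmorphism_eq => a; rewrite componentE of_componentsE. Qed.

Lemma twist_tensor_point_ext R (x y : {lrmorphism T -> R}) :
  (forall j a, x (tin sigma e j a) = y (tin sigma e j a)) -> x = y.
Proof.
move=> xy; apply: lrmorphism_eq; apply: twist_tensor_ext => // c.
exact: etrans (rmorph_alg x c) (esym (rmorph_alg y c)).
Qed.

Definition tmul R (x y : {lrmorphism T -> R}) : {lrmorphism T -> R} :=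
  of_components (fun j => gmul (component x j) (component y j)).
Definition tone R : {lrmorphism T -> R} :=
  of_components (fun j => gone G (tw j R)).
Definition tinv R (x : {lrmorphism T -> R}) : {lrmorphism T -> R} :=
  of_components (fun j => ginv (component x j)).

(** The expansion does not depend on j, which makes the maps between twisted
    products that permute and shift factors compatible with the group laws. *)
Lemma tmul_in R (x y : {lrmorphism T -> R}) j a :
  tmul x y (tin sigma e j a) =
  \sum_(t <- comul (a : GG)) x (tin sigma e j t.1) * y (tin sigma e j t.2).
Proof.
rewrite of_componentsE [LHS](@smulE k GG (tw j R)).
by apply: eq_bigr => t _; rewrite !componentE.
Qed.

Lemma tinv_in R (x : {lrmorphism T -> R}) j a :
  tinv x (tin sigma e j a) = x (tin sigma e j (antipode GG a)).
Proof. by rewrite of_componentsE [LHS](@sinvE k GG (tw j R)) componentE. Qed.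

Definition twist_group : groupScheme k.
Proof.
apply: (@GroupScheme k T tone tinv tmul) => R.
- move=> x y z; apply: twist_tensor_point_ext => j a.
  by rewrite !of_componentsE !component_of gmulA.
- move=> x; apply: twist_tensor_point_ext => j a.
  by rewrite !of_componentsE component_of gmul1 componentE.
- move=> x; apply: twist_tensor_point_ext => j a.
  by rewrite !of_componentsE component_of gmulV.
- move=> S h x y; apply: twist_tensor_point_ext => j a /=.
  rewrite !tmul_in rmorph_sum; apply: eq_bigr => t _.
  exact: rmorphM.
Defined.

End TwistTensorGroup.

(** * Zariski closures are closed subgroups *)

Section TwistTensorGroupMaps.
Context (k : fieldType) (sigma : {rmorphism k -> k}) (G : algGroup k).
Context (J J' : choiceType) (e : J -> nat) (e' : J' -> nat) (h : J -> J').

Local Notation T := (twist_group sigma G e).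
Local Notation T' := (twist_group sigma G e').
Implicit Types R : comAlgType k.

Lemma tincl_mul (he : forall j, e' (h j) = e j) R (x y : {lrmorphism T' -> R}) :
  smul x y \o tincl he = smul (x \o tincl he : {lrmorphism T -> R})
    (y \o tincl he : {lrmorphism T -> R}) :> {lrmorphism T -> R}.
Proof.
apply: twist_tensor_point_ext => j a /=.
rewrite tincl_in !tmul_in; apply: eq_bigr => t _.
by rewrite /= !tincl_in.
Qed.

Lemma tincl_inv (he : forall j, e' (h j) = e j) R (x : {lrmorphism T' -> R}) :
  sinv x \o tincl he = sinv (x \o tincl he : {lrmorphism T -> R})
    :> {lrmorphism T -> R}.
Proof.
apply: twist_tensor_point_ext => j a /=.
by rewrite tincl_in !tinv_in /= tincl_in.
Qed.

Lemma tshift_pullback_exists (he : forall j, e' (h j) = (e j).+1) R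
    (x : {lrmorphism T' -> R}) :
  {y : {lrmorphism T -> twisted sigma R} | forall a, y a = x (tshift he a)}.
Proof.
apply: (@twisted_lrmorphism k sigma T R (x \o tshift he)) => c.
rewrite -[LHS]/(x (tshift he c%:A)) tshiftC; exact: rmorph_alg.
Qed.

(** The shift is not k-linear, so composing with it sends points in R to points in
    the twist of R. *)
Definition tshift_pullback (he : forall j, e' (h j) = (e j).+1) R
    (x : {lrmorphism T' -> R}) : {lrmorphism T -> twisted sigma R} :=
  sval (tshift_pullback_exists he x).

Lemma tshift_pullbackE (he : forall j, e' (h j) = (e j).+1) R
    (x : {lrmorphism T' -> R}) a : tshift_pullback he x a = x (tshift he a).
Proof. exact: (svalP (tshift_pullback_exists he x)). Qed.

Lemma tshift_mul (he : forall j, e' (h j) = (e j).+1) R (x y : {lrmorphism T' -> R}) :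
  tshift_pullback he (smul x y) =
  smul (tshift_pullback he x) (tshift_pullback he y).
Proof.
apply: twist_tensor_point_ext => j a.
rewrite tshift_pullbackE tshift_in !tmul_in; apply: eq_bigr => t _.
by rewrite !tshift_pullbackE !tshift_in.
Qed.

Lemma tshift_inv (he : forall j, e' (h j) = (e j).+1) R (x : {lrmorphism T' -> R}) :
  tshift_pullback he (sinv x) = sinv (tshift_pullback he x).
Proof.
apply: twist_tensor_point_ext => j a.
by rewrite tshift_pullbackE tshift_in !tinv_in tshift_pullbackE tshift_in.
Qed.

End TwistTensorGroupMaps.

Lemma quotient_endomorphism (k : fieldType) (A : comAlgType k) (I : set A)
    (sh : {rmorphism A -> A}) :
  is_ideal I -> ~ I 1 -> (forall f, I f -> I (sh f)) ->
  exists (Q : comAlgType k) (p : {lrmorphism A -> Q}) (s : {rmorphism Q -> Q}),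
    (forall f, p f = 0 <-> I f) /\ forall f, p (sh f) = s (p f).
Proof.
move=> I_ideal I1 I_shift.
have [D [p [p0 p_surj]]] := quotient_algebra I_ideal I1.
pose s d := p (sh (projT1 (cid (p_surj d)))).
have sE f : s (p f) = p (sh f).
  apply/eqP; rewrite -subr_eq0 -linearB -rmorphB; apply/eqP/p0/I_shift/p0.
  by rewrite linearB /= (projT2 (cid (p_surj (p f)))) subrr.
have s_zmod : zmod_morphism s.
  move=> x y; have [a <-] := p_surj x; have [b <-] := p_surj y.
  by rewrite -(rmorphB p) !sE (rmorphB sh) (rmorphB p).
have s_mon : monoid_morphism s.
  split=> [|x y]; first by rewrite -[1 in LHS](rmorph1 p) sE (rmorph1 sh) rmorph1.
  have [a <-] := p_surj x; have [b <-] := p_surj y.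
  by rewrite -(rmorphM p) !sE (rmorphM sh) (rmorphM p).
pose s' : {rmorphism D -> D} := HB.pack s
  (GRing.isZmodMorphism.Build D D s s_zmod) (GRing.isMonoidMorphism.Build D D s s_mon).
by exists D, p, s'; split=> // f; rewrite -[RHS]/(s _) sE.
Qed.

Section SigmaClosed.
Context (k : fieldType) (sigma : {rmorphism k -> k}) (G : algGroup k).
Context (I : set (diff_coord sigma G)).

Local Notation A := (diff_coord sigma G).
Local Notation cd := (coord_diff sigma G).

(** The unit of G in the k-sigma-algebra k is a point of the closed subgroup. *)
Lemma sigma_closed_proper : sigma_closed_subgroup I -> ~ I 1.
Proof.
move=> [_ /(_ (@DiffAlg k sigma k^o sigma _))] grp.
have sC c : (sigma : {rmorphism k^o -> k^o}) c%:A = (sigma c)%:A.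
  by rewrite /GRing.scale /= !mulr1.
have [[psi [_ _ vI]] _ _] := grp sC.
by move=> /vI; rewrite rmorph1 => /eqP; rewrite oner_eq0.
Qed.

Lemma diff_quotient : is_sigma_ideal I -> ~ I 1 ->
  exists (D : diffAlg sigma) (p : {lrmorphism A -> D}),
    (forall f, p f = 0 <-> I f) /\
    forall f, p (diff_shift sigma G f) = diff_op D (p f).
Proof.
move=> [I_ideal I_shift] I1.
have [D [p [s [p0 ps]]]] := quotient_endomorphism I_ideal I1 I_shift.
have sC c : s c%:A = (sigma c)%:A.
  rewrite -(rmorph_alg p c) -ps diff_shiftC; exact: rmorph_alg.
by exists (DiffAlg sC), p; split=> // f; rewrite -ps.
Qed.

(** The endomorphism is sigma (x) sigma, obtained from the universal property with
    the target twisted by sigma. *)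
Lemma diff_tensor (D : diffAlg sigma) : exists (T : tensor_product D D)
    (op : {rmorphism T -> T}), [/\ forall c, op c%:A = (sigma c)%:A,
    forall d, op (tensl T d) = tensl T (diff_op D d)
  & forall d, op (tensr T d) = tensr T (diff_op D d)].
Proof.
have [T] := tensor_product_exists D D; exists T.
have opC (i : {lrmorphism D -> T}) c : (i \o diff_op D) c%:A = (sigma c)%:A.
  by rewrite /= diff_op_alg; apply: rmorph_alg.
have [x xE] := twisted_lrmorphism (opC (tensl T)).
have [y yE] := twisted_lrmorphism (opC (tensr T)).
have [h [hl hr]] := tensor_lift T x y.
exists (h : {rmorphism T -> twisted sigma T}); split=> [c|d|d].
- exact: (rmorph_alg h c).
- exact: etrans (hl d) (xE d).
- exact: etrans (hr d) (yE d).
Qed.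

Fact diff_in_lrmorphism : {f : {lrmorphism G -> A} | forall a, f a = diff_in sigma a}.
Proof.
have Z : scalable (@diff_in k sigma G).
  move=> c a; have -> : c *: a = c%:A * a by rewrite mulr_algl.
  rewrite -[RHS]mulr_algl; apply: etrans (@tinM _ _ _ _ _ _ _ _) _.
  by congr (_ * _); apply: tinC.
pose f : {lrmorphism G -> A} := HB.pack (@diff_in k sigma G)
  (GRing.RMorphism.on (tin sigma id 0%N : G -> A))
  (GRing.isScalable.Build k G A *:%R (@diff_in k sigma G) Z).
by exists f.
Qed.

Definition diff_in_alg : {lrmorphism G -> A} := sval diff_in_lrmorphism.

Lemma diff_in_algE a : diff_in_alg a = tin sigma id 0%N a.
Proof. exact: (svalP diff_in_lrmorphism a). Qed.

Lemma diff_shift_in j a : diff_shift sigma G (tin sigma id j a) = tin sigma id j.+1 a.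
Proof. exact: tshift_in. Qed.

Local Notation AA := (twist_group sigma G id).

Lemma diff_points_comp (R : diffAlg sigma) (x : {lrmorphism A -> R}) :
  (forall f, x (diff_shift sigma G f) = diff_op R (x f)) -> vanishes_on x I ->
  diff_points I R (x \o diff_in_alg : {lrmorphism G -> R}).
Proof.
move=> xs xI; exists x; split=> // a.
by rewrite /= diff_in_algE.
Qed.

(** A sigma-morphism on k{GG} is determined by its restriction to k[GG], and the
    componentwise product of two sigma-morphisms is a sigma-morphism. *)
Lemma diff_points_mul (R : diffAlg sigma) (x y psi : {lrmorphism A -> R}) :
  (forall f, x (diff_shift sigma G f) = diff_op R (x f)) ->
  (forall f, y (diff_shift sigma G f) = diff_op R (y f)) ->
  (forall f, psi (diff_shift sigma G f) = diff_op R (psi f)) ->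
  (forall a, psi (diff_in sigma a) = gmul (x \o diff_in_alg : {lrmorphism G -> R})
    (y \o diff_in_alg : {lrmorphism G -> R}) a) ->
  psi = smul (x : {lrmorphism AA -> R}) y.
Proof.
move=> xs ys psis psi0; apply: twist_tensor_point_ext => j a; rewrite [RHS]tmul_in.
elim: j => [|j IH].
  apply: etrans (psi0 a) _.
  rewrite [LHS](@smulE k (algGroup_scheme G)); apply: eq_bigr => t _ /=.
  by rewrite !diff_in_algE.
rewrite -diff_shift_in [LHS]psis IH rmorph_sum; apply: eq_bigr => t _.
by rewrite -!diff_shift_in xs ys rmorphM.
Qed.

Lemma diff_points_inv (R : diffAlg sigma) (x psi : {lrmorphism A -> R}) :
  (forall f, x (diff_shift sigma G f) = diff_op R (x f)) ->
  (forall f, psi (diff_shift sigma G f) = diff_op R (psi f)) ->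
  (forall a, psi (diff_in sigma a) = ginv (x \o diff_in_alg : {lrmorphism G -> R}) a) ->
  psi = sinv (x : {lrmorphism AA -> R}).
Proof.
move=> xs psis psi0; apply: twist_tensor_point_ext => j a; rewrite [RHS]tinv_in.
elim: j => [|j IH].
  apply: etrans (psi0 a) _.
  by rewrite [LHS](@sinvE k (algGroup_scheme G)) /= diff_in_algE.
by rewrite -!diff_shift_in [LHS]psis IH xs.
Qed.

Context (I_closed : sigma_closed_subgroup I).

Local Notation Ai i := (twist_group sigma G (fun j : 'I_i.+1 => j : nat)).

Lemma coord_diff_mul i (R : comAlgType k) (x y : {lrmorphism AA -> R}) f :
  smul x y (cd i f) = smul (x \o cd i : {lrmorphism Ai i -> R})
    (y \o cd i : {lrmorphism Ai i -> R}) f.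
Proof.
by have /(congr1 (fun z : {lrmorphism Ai i -> R} => z f)) := @tincl_mul k sigma G
  _ _ (fun j : 'I_i.+1 => j : nat) id (@nat_of_ord i.+1) (fun=> erefl) R x y.
Qed.

Lemma coord_diff_inv i (R : comAlgType k) (x : {lrmorphism AA -> R}) f :
  sinv x (cd i f) = sinv (x \o cd i : {lrmorphism Ai i -> R}) f.
Proof.
by have /(congr1 (fun z : {lrmorphism Ai i -> R} => z f)) := @tincl_inv k sigma G
  _ _ (fun j : 'I_i.+1 => j : nat) id (@nat_of_ord i.+1) (fun=> erefl) R x.
Qed.

(** The product of the two universal points of G, with values in D (x) D for
    D = k{GG}/I, vanishes on I.  On k[GG[i]] it is the comultiplication, so the
    comultiplication of an element of I(G[i]) vanishes in D (x) D, and
    [pairing_eq0] carries this over to all pairs of points of G[i]. *)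
Lemma zclosure_mul i (R : comAlgType k) (x y : {lrmorphism Ai i -> R}) :
  vanishes_on x (zclosure I i) -> vanishes_on y (zclosure I i) ->
  vanishes_on (smul x y) (zclosure I i).
Proof.
move=> xI yI f If.
have [D [p [p0 ps]]] := diff_quotient I_closed.1 (sigma_closed_proper I_closed).
have [T [op [opC opl opr]]] := diff_tensor D.
pose TD := DiffAlg opC.
pose pl : {lrmorphism A -> TD} := tensl T \o p.
pose pr : {lrmorphism A -> TD} := tensr T \o p.
have pls g : pl (diff_shift sigma G g) = diff_op TD (pl g) by rewrite /pl /= ps opl.
have prs g : pr (diff_shift sigma G g) = diff_op TD (pr g) by rewrite /pr /= ps opr.
have plI : vanishes_on pl I by move=> g /p0 pg; rewrite /pl /= pg rmorph0.
have prI : vanishes_on pr I by move=> g /p0 pg; rewrite /pr /= pg rmorph0.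
have [_ /(_ _ _ (diff_points_comp pls plI) (diff_points_comp prs prI)) mulP _] :=
  I_closed.2 TD.
have [psi [psis psi0 psiI]] := mulP.
have psiE := diff_points_mul pls prs psis psi0.
pose q : {lrmorphism Ai i -> D} := p \o cd i.
have q0 g : q g = 0 <-> zclosure I i g by exact: p0.
have qx : through q x by move=> g /q0/xI.
have qy : through q y by move=> g /q0/yI.
rewrite smulE; apply: (pairing_eq0 qx qy) => l.
have [L LE] := tensor_contract T l.
have E : \sum_(t <- comul (f : Ai i)) tensl T (q t.1) * tensr T (q t.2) = 0.
  rewrite -[RHS](psiI _ If) psiE.
  by rewrite coord_diff_mul smulE.
have := congr1 L E; rewrite linear0 => E0; rewrite -[RHS]E0 (linear_sum L).
by apply: eq_bigr => t _; rewrite LE.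
Qed.

(** The inverse of the universal point of G vanishes on I, hence I(G[i]) is stable
    under the antipode. *)
Lemma zclosure_inv i (R : comAlgType k) (x : {lrmorphism Ai i -> R}) :
  vanishes_on x (zclosure I i) -> vanishes_on (sinv x) (zclosure I i).
Proof.
move=> xI f If.
have [D [p [p0 ps]]] := diff_quotient I_closed.1 (sigma_closed_proper I_closed).
have pI : vanishes_on p I by move=> g /p0.
have [_ _ /(_ _ (diff_points_comp ps pI)) invP] := I_closed.2 D.
have [psi [psis psi0 psiI]] := invP.
have psiE := diff_points_inv ps psis psi0.
rewrite sinvE; apply: xI; apply/p0.
rewrite -[LHS](sinvE (p \o cd i : {lrmorphism Ai i -> D})) -coord_diff_inv.
by rewrite -[RHS](psiI _ If) psiE.
Qed.

End SigmaClosed.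

(** * Ascending chains of ideals up to a twist *)

Lemma nondecreasing_subsequence (u : nat -> nat) : exists phi : nat -> nat,
  forall a b, (a < b)%N -> (phi a < phi b)%N /\ (u (phi a) <= u (phi b))%N.
Proof.
have min_tail m : exists j, (m <= j)%N /\ forall j', (m <= j')%N -> (u j <= u j')%N.
  pose Q v := `[< exists j, (m <= j)%N /\ u j = v >].
  have exQ : exists v, Q v by exists (u m); apply/asboolP; exists m.
  case: (ex_minnP exQ) => _ /asboolP[j [mj <-]] uj_min; exists j; split=> // j' mj'.
  by apply: uj_min; apply/asboolP; exists j'.
have [g gP] := choice min_tail.
pose phi := fix phi a := if a is b.+1 then g (phi b).+1 else g 0%N.
have phiS a : (phi a < phi a.+1)%N by exact: (gP (phi a).+1).1.
have phi_lt : {homo phi : a b / (a < b)%N} by apply: homo_ltn => //; exact: ltn_trans.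
exists phi => a b ab; split; first exact: phi_lt.
case: a ab => [|a] /phi_lt; first by move=> _; exact: (gP 0%N).2.
move=> lt; apply: (gP (phi a).+1).2; apply: leq_trans (ltnW lt); exact: phiS.
Qed.

(** Extract a subsequence that is nondecreasing in one coordinate after another. *)
Lemma dickson n (u : nat -> 'I_n -> nat) :
  exists a b, (a < b)%N /\ forall i, (u a i <= u b i)%N.
Proof.
suff [phi phiP] : exists phi : nat -> nat, forall a b, (a < b)%N ->
    (phi a < phi b)%N /\ forall i, i \in enum 'I_n -> (u (phi a) i <= u (phi b) i)%N.
  exists (phi 0%N), (phi 1%N); have [//|lt le] := phiP 0%N 1%N.
  by split=> // i; apply: le; rewrite mem_enum.
elim: (enum 'I_n) => [|i s [phi phiP]]; first by exists id.
have [psi psiP] := nondecreasing_subsequence (fun a => u (phi a) i).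
exists (phi \o psi) => a b /psiP[lt le]; have [lt' le'] := phiP _ _ lt.
by split=> // j; rewrite inE => /predU1P[->|/le'].
Qed.

(** Otherwise choose infinitely many stages at which a new monomial appears; by
    Dickson's lemma one of these monomials is divisible by an earlier one, so it
    was not new. *)
Lemma upward_closed_chain_stationary n (L : nat -> ('I_n -> nat) -> Prop) :
  (forall i m, L i m -> L i.+1 m) ->
  (forall i m m', (forall j, (m j <= m' j)%N) -> L i m -> L i m') ->
  exists N, forall i, (N <= i)%N -> forall m, L i.+1 m -> L i m.
Proof.
move=> L_inc L_up; apply: contrapT => no.
have bad N : exists im : nat * ('I_n -> nat),
    [/\ (N <= im.1)%N, L im.1.+1 im.2 & ~ L im.1 im.2].
  apply: contrapT => noN; apply: no; exists N => i Ni m Lm.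
  by apply: contrapT => nLm; apply: noN; exists (i, m).
have [f fP] := choice bad.
pose st := fix st a := if a is b.+1 then f (st b).1.+1 else f 0%N.
have stP a : L (st a).1.+1 (st a).2 /\ ~ L (st a).1 (st a).2.
  by case: a => [|a]; [have [] := fP 0%N|have [] := fP (st a).1.+1].
have st_lt : {homo (fun a => (st a).1) : a b / (a < b)%N}.
  apply: homo_ltn => [? ? ?|a]; first exact: ltn_trans.
  by have [] := fP (st a).1.+1.
have L_le i j m : (i <= j)%N -> L i m -> L j m.
  by move=> ij Lm; rewrite -(subnK ij); elim: (j - i)%N => // d; apply: L_inc.
have [a [b [/st_lt ab le]]] := dickson (fun a => (st a).2).
by apply: (stP b).2; apply: L_up le _; apply: L_le ab (stP a).1.
Qed.

Section TwistedChains.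
Import mpoly.
Context (k : fieldType) (sigma : {rmorphism k -> k}).

(** Once the sets of leading monomials are constant, an element of the ideal p (i+1)
    is reduced, by induction on its leading monomial, by multiples of
    images of elements of p i.  The leading monomial of such an image is that of
    the element because sigma is injective on the coefficients. *)
Lemma twisted_poly_chain n (p : nat -> set (mpoly.mpoly n k)) :
  (forall i, is_ideal (p i)) ->
  (forall i f, p i f -> p i.+1 (map_mpoly sigma f)) ->
  exists N, forall i, (N <= i)%N -> forall J, is_ideal J ->
    (forall f, p i f -> J (map_mpoly sigma f)) -> forall f, p i.+1 f -> J f.
Proof.
move=> p_ideal p_shift.
have lead_shift (f : mpoly.mpoly n k) : mlead (map_mpoly sigma f) = mlead f.
  rewrite /mlead; apply: perm_big; apply: msupp_map_mpoly; exact: fmorph_inj.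
pose L i (m : 'I_n -> nat) := exists f, [/\ p i f, f != 0 & forall j, mlead f j = m j].
have [i m [f [pf f0 fm]]|i m m' mm' [f [pf f0 fm]]|N NP] :=
    @upward_closed_chain_stationary n L.
- exists (map_mpoly sigma f); split=> [||j]; [exact: p_shift| |by rewrite lead_shift].
  apply: contra_neq f0 => /mpolyP fs0; apply/mpolyP => l.
  apply: (fmorph_inj sigma); rewrite -mcoeff_map_mpoly fs0 !mcoeff0 rmorph0 //.
- pose d := [multinom m' j - mlead f j | j < n].
  have X0 : 'X_[d] != 0 :> mpoly.mpoly n k.
    by apply/eqP => /mpolyP/(_ d); rewrite mcoeffX eqxx mcoeff0 => /eqP; rewrite oner_eq0.
  exists ('X_[d] * f); split=> [||j].
  + by have [_ _ pM] := p_ideal i; apply: pM.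
  + by rewrite mulf_neq0.
  + by rewrite mleadM // mleadXm mnmDE mnmE fm subnK.
exists N => i Ni J [J0 JD JM] Jp f; elim/mleadrect: f => f IH pf.
have [->//|f0] := eqVneq f 0.
have [|g [pg g0 gf]] := NP i Ni (mlead f).
  by exists f.
have lg : mlead g = mlead f by apply/mnmP.
pose c := mleadc f / sigma (mleadc g).
pose h := f - c *: map_mpoly sigma g.
have gl : mlead (map_mpoly sigma g) = mlead f by rewrite lead_shift.
have Jh : J (c *: map_mpoly sigma g) by rewrite -mul_mpolyC; apply/JM/Jp.
suff : J h by move=> /JD/(_ Jh); rewrite subrK.
have ph : p i.+1 h.
  have [_ pD pM] := p_ideal i.+1; apply: pD => //.
  by rewrite -scaleNr -mul_mpolyC; apply/pM/p_shift.
have [->//|h0] := eqVneq h 0.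
apply: IH ph; rewrite lt_neqAle; apply/andP; split.
  apply: contra_neq h0 => hf; apply/eqP; rewrite -mleadc_eq0 hf mcoeffB mcoeffZ.
  rewrite mcoeff_map_mpoly -lg -/c divfK ?lg ?subrr //.
  by rewrite fmorph_eq0 -lg mleadc_eq0.
apply: le_trans (mleadB_le _ _) _; rewrite leUx lexx -gl.
exact: mleadZ_le.
Qed.

(** The P i are all quotients of the same polynomial ring, compatibly with sigma, so
    that the preceding lemma applies to the preimages of the ideals. *)
Theorem twisted_ideal_chain n (P : nat -> comAlgType k)
    (x : forall i, 'I_n -> P i) (s : forall i, {rmorphism P i -> P i.+1})
    (I : forall i, set (P i)) :
  (forall i a, exists f, a = mmap (GRing.in_alg (P i)) (x i) f) ->
  (forall i c, s i c%:A = (sigma c)%:A) ->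
  (forall i j, s i (x i j) = x i.+1 j) ->
  (forall i, is_ideal (I i)) -> (forall i a, I i a -> I i.+1 (s i a)) ->
  exists N, forall i, (N <= i)%N -> forall J, is_ideal J ->
    (forall a, I i a -> J (s i a)) -> forall a, I i.+1 a -> J a.
Proof.
move=> x_gen sC sx I_ideal I_shift.
pose phi i : {rmorphism mpoly.mpoly n k -> P i} := mmap (GRing.in_alg (P i)) (x i).
have phi_s i f : phi i.+1 (map_mpoly sigma f) = s i (phi i f).
  rewrite /phi /= /mmap rmorph_sum.
  rewrite (perm_big _ (msupp_map_mpoly f (fmorph_inj sigma))); apply: eq_bigr => m _.
  rewrite mcoeff_map_mpoly !rmorphM /= sC; congr (_ * _).
  by rewrite /mmap1 rmorph_prod; apply: eq_bigr => j _; rewrite rmorphXn /= sx.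
have pre_ideal i (J : set (P i)) : is_ideal J -> is_ideal (phi i @^-1` J).
  move=> [J0 JD JM]; split=> [|f g Jf Jg|f g Jg] /=.
  - by rewrite rmorph0.
  - by rewrite rmorphD; apply: JD.
  - by rewrite rmorphM; apply: JM.
have [N NP] := @twisted_poly_chain n (fun i => phi i @^-1` I i)
  (fun i => pre_ideal i _ (I_ideal i))
  (fun i f If => eq_ind_r (I i.+1) (I_shift i _ If) (phi_s i f)).
exists N => i Ni J J_ideal IJ a Ia; have [f fE] := x_gen i.+1 a.
rewrite fE; apply: (NP i Ni _ (pre_ideal i.+1 J J_ideal)); last by rewrite fE in Ia.
by move=> g Ig /=; rewrite phi_s; apply: IJ.
Qed.

End TwistedChains.

(** * The last factor of a twisted product *)

Lemma vanishes_on_gen (A R : comNzRingType) (x : {rmorphism A -> R}) (S : set A) :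
  vanishes_on x (ideal_gen S) <-> vanishes_on x S.
Proof.
split=> [xS f Sf|xS f]; first by apply: xS => I [_]; apply.
by apply: (@smallest_sub _ _ _ [set x' | x x' = 0]); [exact: ker_is_ideal|].
Qed.

Section TwistTensorGenerators.
Context (k : fieldType) (sigma : {rmorphism k -> k}) (G : algGroup k).
Context (J : choiceType) (e : J -> nat).

Local Notation T := (twist_tensor sigma G e).

Lemma twist_tensor_rect (P : T -> Prop) :
  (forall c : k, P c%:A) -> (forall j a, P (tin sigma e j a)) ->
  (forall x y, P x -> P y -> P (x + y)) -> (forall x y, P x -> P y -> P (x * y)) ->
  forall x, P x.
Proof.
move=> PC Pin PD PM f.
have P1 : P 1 by have := PC 1; rewrite scale1r.
have P0 : P 0 by have := PC 0; rewrite scale0r.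
have [p <-] := tpi_surj f.
rewrite (monalgE p) (rmorph_sum (@tpi _ _ _ _ _)).
apply: (big_ind P P0 PD) => m _; rewrite malg_monev (rmorphM (@tpi _ _ _ _ _)).
apply: (PM); first by rewrite -[X in P X]/(tpi _ _ _%:A) tpiC.
rewrite /monev (rmorph_prod (@tpi _ _ _ _ _)).
apply: (big_ind P P1 PM) => -[j a] _; rewrite (rmorphXn (@tpi _ _ _ _ _)).
elim: (m _) => [|n IH]; first by rewrite expr0.
by rewrite exprS; apply: PM => //; apply: Pin.
Qed.

Lemma tone_in R j a : tone sigma G e R (tin sigma e j a) =
  (iter (e j) sigma (augmentation (a : algGroup_scheme G)))%:A.
Proof.
rewrite of_componentsE [LHS](@soneE k (algGroup_scheme G)) /=.
by rewrite -(svalP (sigma_iter sigma (e j))).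
Qed.

Lemma augmentation_in j a :
  augmentation (tin sigma e j a : twist_group sigma G e) =
  iter (e j) sigma (augmentation (a : algGroup_scheme G)).
Proof. by rewrite /augmentation [LHS]tone_in /GRing.scale /= mulr1. Qed.

End TwistTensorGenerators.

Section LastFactor.
Context (k : fieldType) (sigma : {rmorphism k -> k}) (G : algGroup k).

(** The coordinate ring of the twist of GG by sigma^i: a product with one factor. *)
Definition factor i : comAlgType k := twist_tensor sigma G (fun _ : unit => i).

Definition factor_shift i : {rmorphism factor i -> factor i.+1} :=
  tshift (h := @id unit) (fun=> erefl).

Definition factor_incl i : {lrmorphism factor i -> coord_prod sigma G i} :=
  tincl (h := fun _ : unit => (ord_max : 'I_i.+1)) (fun=> erefl).

Local Notation eo i := (fun j : 'I_i.+1 => j : nat).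
Local Notation aug a := (augmentation (a : algGroup_scheme G)).

Fact last_factor_exists i : {r : {lrmorphism coord_prod sigma G i -> factor i} |
  (forall a, r (tin sigma (eo i) ord_max a) = tin sigma (fun _ : unit => i) tt a) /\
  forall j a, j != ord_max -> r (tin sigma (eo i) j a) = (iter j sigma (aug a))%:A}.
Proof.
(* Restriction to the subgroup of points whose first i components are trivial. *)
pose phi (j : 'I_i.+1) : {rmorphism G -> factor i} :=
  if j == ord_max
  then (tin sigma (fun _ : unit => i) tt : {rmorphism G -> factor i})
  else tone sigma G (eo i) (factor i) \o tin sigma (eo i) j.
have phi_semi : twist_semilinear sigma (eo i) (GRing.in_alg (factor i)) phi.
  move=> j c; rewrite /phi; case: eqP => [->|_]; first exact: tinC.
  rewrite -[LHS]/(tone _ _ _ _ (tin _ _ _ _)) tinC; exact: rmorph_alg.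
exists (tlift_alg phi_semi); split=> [a|j a /negPf jmax].
  by apply: etrans (tlift_in phi_semi _ _) _; rewrite /phi eqxx.
by apply: etrans (tlift_in phi_semi _ _) _; rewrite /phi jmax; apply: tone_in.
Qed.

Definition last_factor i : {lrmorphism coord_prod sigma G i -> factor i} :=
  sval (last_factor_exists i).

Lemma last_factor_max i a :
  last_factor i (tin sigma (eo i) ord_max a) = tin sigma (fun _ : unit => i) tt a.
Proof. exact: (svalP (last_factor_exists i)).1. Qed.

Lemma last_factor_lt i j a : j != ord_max ->
  last_factor i (tin sigma (eo i) j a) = (iter j sigma (aug a))%:A.
Proof. exact: (svalP (last_factor_exists i)).2. Qed.

Lemma last_factorK i f : last_factor i (factor_incl i f) = f.
Proof.
apply: (twist_tensor_ext (f := last_factor i \o factor_incl i) (g := idfun)) => [c|[] a] /=.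
  rewrite tinclC; exact: (rmorph_alg (last_factor i) c).
by rewrite tincl_in last_factor_max.
Qed.

Lemma last_factor_shift i f :
  last_factor i.+1 (coord_shift sigma G i f) = factor_shift i (last_factor i f).
Proof.
apply: (twist_tensor_ext (f := last_factor i.+1 \o coord_shift sigma G i)
  (g := factor_shift i \o last_factor i)) => [c|j a] /=.
  rewrite tshiftC; apply: etrans (rmorph_alg (last_factor i.+1) (sigma c)) _.
  apply/esym; apply: etrans (congr1 (factor_shift i) (rmorph_alg (last_factor i) c)) _.
  exact: tshiftC.
rewrite tshift_in; have [->|jmax] := eqVneq j ord_max.
  have -> : lift ord0 (ord_max : 'I_i.+1) = ord_max by apply: val_inj.
  rewrite !last_factor_max; apply/esym; exact: tshift_in.
rewrite !last_factor_lt //; apply/esym; exact: tshiftC.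
Qed.

(** Modulo the ideal generated by the augmentation ideal of the first factors, f is
    equal to its image in the last factor, since this is so for the
    generators. *)
Lemma last_factor_kernel i f : last_factor i.+1 f = 0 ->
  exists s : seq (coord_prod sigma G i * coord_prod sigma G i.+1),
    (forall t, t \in s -> augmentation
       (coord_incl sigma G i t.1 : twist_group sigma G (eo i.+1)) = 0) /\
    f = \sum_(t <- s) coord_incl sigma G i t.1 * t.2.
Proof.
pose K : set (coord_prod sigma G i.+1) := [set f |
  exists s : seq (coord_prod sigma G i * coord_prod sigma G i.+1),
    (forall t, t \in s -> augmentation
       (coord_incl sigma G i t.1 : twist_group sigma G (eo i.+1)) = 0) /\
    f = \sum_(t <- s) coord_incl sigma G i t.1 * t.2].
have K_ideal : is_ideal K.
  split=> [|_ _ [s [s0 ->]] [s' [s'0 ->]]|a _ [s [s0 ->]]].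
  - by exists [::]; rewrite big_nil.
  - exists (s ++ s'); rewrite big_cat; split=> // t.
    by rewrite mem_cat => /orP[/s0|/s'0].
  - exists [seq (t.1, a * t.2) | t <- s]; split=> [_ /mapP[t ts ->]|].
      exact: (s0 t ts).
    rewrite big_map mulr_sumr; apply: eq_bigr => t _ /=; exact: mulrCA.
move=> f0; rewrite -/(K f).
have [K1|K1] := pselect (K 1).
  by have [_ _ /(_ f 1 K1)] := K_ideal; rewrite mulr1.
have [Q [pi [pi0 _]]] := quotient_algebra K_ideal K1.
apply/pi0.
have -> : pi f = pi (factor_incl i.+1 (last_factor i.+1 f)).
  apply: (twist_tensor_ext (f := pi)
    (g := pi \o factor_incl i.+1 \o last_factor i.+1)) => [c|j a] /=.
    apply/esym; congr (pi _).
    exact: etrans (congr1 (factor_incl i.+1) (rmorph_alg (last_factor i.+1) c))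
      (rmorph_alg (factor_incl i.+1) c).
  have [->|jmax] := eqVneq j ord_max.
    by rewrite last_factor_max; congr (pi _); apply/esym; apply: tincl_in.
  rewrite last_factor_lt //; apply/eqP; rewrite -subr_eq0 -(rmorphB pi); apply/eqP/pi0.
  have ji : (j < i.+1)%N.
    by have := ltn_ord j; rewrite ltnS leq_eqVlt => /predU1P[E|//];
      case/eqP: jmax; apply: val_inj.
  pose b := tin sigma (eo i) (Ordinal ji) a - (iter j sigma (aug a))%:A.
  have bE : coord_incl sigma G i b = tin sigma (eo i.+1) j a - (iter j sigma (aug a))%:A.
    rewrite /b (rmorphB (coord_incl sigma G i)); congr (_ - _); last by rewrite [LHS]tinclC.
    by rewrite [LHS]tincl_in; congr (tin _ _ _ _); apply: val_inj.
  exists [:: (b, 1)]; split=> [t|]; last first.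
    rewrite big_seq1 mulr1 bE; congr (_ - _); exact: rmorph_alg.
  rewrite inE => /eqP ->; rewrite -[(b, 1).1]/b bE.
  rewrite [LHS](@augmentationB k (twist_group sigma G (eo i.+1))).
  by rewrite augmentation_in [X in _ - X]augmentationC subrr.
by rewrite f0 (linear0 (factor_incl i.+1)) linear0.
Qed.

End LastFactor.

(** * Stabilization of the Zariski closures *)

Lemma image_ideal (A B : comNzRingType) (r : {rmorphism A -> B}) (I : set A) :
  (forall b, exists a, r a = b) -> is_ideal I -> is_ideal (r @` I).
Proof.
move=> r_surj [I0 ID IM]; split=> [|_ _ [x Ix <-] [y Iy <-]|b _ [x Ix <-]].
- by exists 0 => //; rewrite rmorph0.
- by exists (x + y); [exact: ID|rewrite rmorphD].
- by have [a <-] := r_surj b; exists (a * x); [exact: IM|rewrite rmorphM].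
Qed.

Lemma preimage_ideal (A B : comNzRingType) (r : {rmorphism A -> B}) (I : set B) :
  is_ideal I -> is_ideal (r @^-1` I).
Proof.
move=> [I0 ID IM]; split=> [|x y Ix Iy|a x Ix] /=.
- by rewrite rmorph0.
- by rewrite rmorphD; apply: ID.
- by rewrite rmorphM; apply: IM.
Qed.

Section Generators.
Import mpoly.
Context (k : fieldType) (sigma : {rmorphism k -> k}) (G : algGroup k).

Lemma mmap_algD (R : comAlgType k) n (x : 'I_n -> R) (f g : mpoly.mpoly n k) :
  mmap (GRing.in_alg R) x (f + g) =
  mmap (GRing.in_alg R) x f + mmap (GRing.in_alg R) x g.
Proof. exact: mmapD. Qed.

Lemma mmap_algM (R : comAlgType k) n (x : 'I_n -> R) (f g : mpoly.mpoly n k) :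
  mmap (GRing.in_alg R) x (f * g) =
  mmap (GRing.in_alg R) x f * mmap (GRing.in_alg R) x g.
Proof. exact: (rmorphM (mmap (GRing.in_alg R) x : {rmorphism mpoly.mpoly n k -> R})). Qed.

(** Twist by sigma^i the coefficients of a polynomial that represents the given
    element of k[GG]. *)
Lemma factor_generated n (g : 'I_n -> G) i :
  (forall a, exists p : mpoly.mpoly n k, a = mpoly.mmap (GRing.in_alg G) g p) ->
  forall a : factor sigma G i, exists p : mpoly.mpoly n k,
    a = mpoly.mmap (GRing.in_alg (factor sigma G i))
      (fun l => tin sigma (fun _ : unit => i) tt (g l)) p.
Proof.
move=> gen.
set x := (X in mpoly.mmap _ X).
apply: (@twist_tensor_rect k sigma G unit (fun=> i)) 
  => [c|[] a|a b [p ->] [q ->]|a b [p ->] [q ->]].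
- by exists (mpoly.mpolyC n c); rewrite mpoly.mmapC.
- have [p ->] := gen a; exists (mpoly.map_mpoly (sval (sigma_iter sigma i)) p).
  rewrite /mpoly.mmap (perm_big _ (mpoly.msupp_map_mpoly p (fmorph_inj _))).
  rewrite (rmorph_sum (tin sigma (fun _ : unit => i) tt)).
  apply: eq_bigr => m _; rewrite mpoly.mcoeff_map_mpoly.
  rewrite (rmorphM (tin sigma (fun _ : unit => i) tt)); congr (_ * _).
    by rewrite -[LHS]/(tin _ _ _ _) tinC /= (svalP (sigma_iter sigma i)).
  rewrite /mpoly.mmap1 (rmorph_prod (tin sigma (fun _ : unit => i) tt)).
  by apply: eq_bigr => l _; rewrite (rmorphXn (tin sigma (fun _ : unit => i) tt)).
- by exists (p + q); apply/esym/mmap_algD.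
- by exists (p * q); apply/esym/mmap_algM.
Qed.

End Generators.

Section Stabilization.
Context (k : fieldType) (sigma : {rmorphism k -> k}) (G : algGroup k).
Context (I : set (diff_coord sigma G)).

(** The ideal of the intersection of G[i] x sigma^(i+1)(GG) with
    GG x sigma(G[i]). *)
Definition next_ideal i : set (coord_prod sigma G i.+1) :=
  ideal_gen (coord_incl sigma G i @` zclosure I i `|`
             coord_shift sigma G i @` zclosure I i).

Arguments next_ideal i _ : clear implicits.

Lemma vanishes_on_next i (R : comNzRingType)
    (x : {rmorphism coord_prod sigma G i.+1 -> R}) :
  vanishes_on x (next_ideal i) <->
  vanishes_on (x \o coord_incl sigma G i) (zclosure I i) /\
  vanishes_on (x \o coord_shift sigma G i) (zclosure I i).
Proof.
rewrite vanishes_on_gen; split=> [xS|[x1 x2] _ [[f If <-]|[f If <-]]].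
- by split=> f If; apply: xS; [left|right]; exists f.
- exact: x1.
- exact: x2.
Qed.

Context (I_closed : sigma_closed_subgroup I).

Lemma zclosure_ideal i : is_ideal (zclosure I i).
Proof. exact: preimage_ideal (coord_diff sigma G i) _ I_closed.1.1. Qed.

Lemma zclosure_incl i f : zclosure I i.+1 (coord_incl sigma G i f) <-> zclosure I i f.
Proof. by rewrite /zclosure /preimage /= coord_diff_incl. Qed.

Lemma zclosure_shift i f : zclosure I i f -> zclosure I i.+1 (coord_shift sigma G i f).
Proof.
by rewrite /zclosure /preimage /= coord_diff_shift; apply: I_closed.1.2.
Qed.

Lemma next_ideal_sub i : next_ideal i `<=` zclosure I i.+1.
Proof.
apply: smallest_sub; first exact: zclosure_ideal.
move=> _ [[f If <-]|[f If <-]]; first exact/zclosure_incl.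
exact: zclosure_shift.
Qed.

Lemma zclosure_proper i : ~ zclosure I i 1.
Proof.
rewrite /zclosure /preimage /= (rmorph1 (coord_diff sigma G i)).
exact: sigma_closed_proper.
Qed.

(** The images of the ideals I(G[i]) in the coordinate rings of the last factors
    satisfy the hypotheses of [twisted_ideal_chain]. *)
Lemma last_factor_chain : exists N, forall i, (N <= i)%N -> forall f,
  zclosure I i.+1 f -> exists2 b, next_ideal i b &
    last_factor sigma G i.+1 (f - b) = 0.
Proof.
have [n [g gen]] := coord_fg G.
have surj i b : exists a, last_factor sigma G i a = b.
  by exists (factor_incl sigma G i b); apply: last_factorK.
have [N NP] := @twisted_ideal_chain k sigma n (factor sigma G)
  (fun i l => tin sigma (fun _ : unit => i) tt (g l)) (factor_shift sigma G)
  (fun i => last_factor sigma G i @` zclosure I i)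
  (fun i => factor_generated gen (i := i)) (fun i => tshiftC sigma G (fun=> erefl))
  (fun i l => tshift_in sigma (fun=> erefl) tt (g l))
  (fun i => image_ideal (surj i) (zclosure_ideal i))
  (fun i _ fP => let: ex_intro2 f If E := fP in
     ex_intro2 _ _ (coord_shift sigma G i f) (zclosure_shift If)
       (etrans (last_factor_shift f) (congr1 _ E))).
exists N => i Ni f If.
have [|_ [a Ia <-]||b nb E] := NP i Ni
  (last_factor sigma G i.+1 @` next_ideal i) _ _ (last_factor sigma G i.+1 f).
- exact: (@image_ideal _ _ (last_factor sigma G i.+1) _ (surj i.+1) (ideal_gen_is_ideal _)).
- exists (coord_shift sigma G i a); last exact: last_factor_shift.
  by move=> J [_]; apply; right; exists a.
- by exists f.
exists b => //; apply/eqP.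
by rewrite (rmorphB (last_factor sigma G i.+1)) subr_eq0; apply/eqP/esym.
Qed.

Local Notation eo i := (fun j : 'I_i.+1 => j : nat).
Local Notation Ai i := (twist_group sigma G (eo i)).

Lemma coord_incl_mul i (R : comAlgType k) (x y : {lrmorphism Ai i.+1 -> R}) f :
  smul x y (coord_incl sigma G i f) =
  smul (x \o coord_incl sigma G i : {lrmorphism Ai i -> R})
    (y \o coord_incl sigma G i : {lrmorphism Ai i -> R}) f.
Proof.
by have /(congr1 (fun z : {lrmorphism Ai i -> R} => z f)) := @tincl_mul k sigma G
  _ _ (eo i) (eo i.+1) (widen_ord (leqnSn i.+1)) (fun=> erefl) R x y.
Qed.

Lemma coord_incl_inv i (R : comAlgType k) (x : {lrmorphism Ai i.+1 -> R}) f :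
  sinv x (coord_incl sigma G i f) =
  sinv (x \o coord_incl sigma G i : {lrmorphism Ai i -> R}) f.
Proof.
by have /(congr1 (fun z : {lrmorphism Ai i -> R} => z f)) := @tincl_inv k sigma G
  _ _ (eo i) (eo i.+1) (widen_ord (leqnSn i.+1)) (fun=> erefl) R x.
Qed.

(** A point satisfies the equations of the next ideal if and only if its
    first components and its last components, the latter read in the twist of R, are
    points of G[i]; both conditions are stable under products. *)
Lemma next_ideal_mul i (R : comAlgType k) (x y : {lrmorphism Ai i.+1 -> R}) :
  vanishes_on x (next_ideal i) -> vanishes_on y (next_ideal i) ->
  vanishes_on (smul x y) (next_ideal i).
Proof.
move=> /vanishes_on_next[x1 x2] /vanishes_on_next[y1 y2].
apply/vanishes_on_next; split=> f If.
  by apply: etrans (coord_incl_mul x y f) _; apply: (zclosure_mul I_closed x1 y1).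
have := @tshift_mul k sigma G _ _ (eo i) (eo i.+1) (lift ord0) (@lift0 i.+1) R x y.
move=> /(congr1 (fun z : {lrmorphism Ai i -> twisted sigma R} => z f)).
rewrite tshift_pullbackE => E; apply: etrans E _.
by apply: (zclosure_mul I_closed) If => h Ih;
  rewrite tshift_pullbackE; [apply: x2|apply: y2].
Qed.

Lemma next_ideal_inv i (R : comAlgType k) (x : {lrmorphism Ai i.+1 -> R}) :
  vanishes_on x (next_ideal i) -> vanishes_on (sinv x) (next_ideal i).
Proof.
move=> /vanishes_on_next[x1 x2]; apply/vanishes_on_next; split=> f If.
  by apply: etrans (coord_incl_inv x f) _; apply: (zclosure_inv I_closed x1).
have := @tshift_inv k sigma G _ _ (eo i) (eo i.+1) (lift ord0) (@lift0 i.+1) R x.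
move=> /(congr1 (fun z : {lrmorphism Ai i -> twisted sigma R} => z f)).
rewrite tshift_pullbackE => E; apply: etrans E _.
by apply: (zclosure_inv I_closed) If => h Ih; rewrite tshift_pullbackE; apply: x2.
Qed.

Theorem zclosure_next : exists N, forall i, (N <= i)%N ->
  zclosure I i.+1 = next_ideal i.
Proof.
have [N NP] := last_factor_chain; exists N => i Ni.
apply/seteqP; split=> [f If|]; last exact: next_ideal_sub.
have n1 : ~ next_ideal i 1 by move=> /next_ideal_sub/zclosure_proper.
have [C [p [p0 _]]] := quotient_algebra (ideal_gen_is_ideal _) n1.
have [D [q [q0 _]]] := quotient_algebra (zclosure_ideal i.+1) (@zclosure_proper i.+1).
pose H := Ai i.+1; pose H0 := Ai i.
pose eps : {rmorphism H0 -> k} :=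
  (sone H k^o : {rmorphism H -> k}) \o coord_incl sigma G i.
have throughE (E : comAlgType k) (r : {lrmorphism H -> E}) J
    (R : comAlgType k) (x : {lrmorphism H -> R}) :
  (forall h, r h = 0 <-> J h) -> through r x <-> vanishes_on x J.
  by move=> rJ; split=> rx h /rJ/rx.
apply/p0; apply: (@equal_of_same_kernel_image k H H0 (coord_incl sigma G i) _ C D p q
  _ _ _ _ _ _ _ eps _ f); last exact/q0.
- exact: coord_incl_mul.
- by move=> h /p0/next_ideal_sub/q0.
- move=> R x y /(throughE _ _ _ _ _ p0) xn /(throughE _ _ _ _ _ p0) yn.
  by apply/(throughE _ _ _ _ _ p0); apply: next_ideal_mul.
- move=> R x /(throughE _ _ _ _ _ p0) xn.
  by apply/(throughE _ _ _ _ _ p0); apply: next_ideal_inv.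
- move=> R x y /(throughE _ _ _ _ _ q0) xn /(throughE _ _ _ _ _ q0) yn.
  by apply/(throughE _ _ _ _ _ q0); apply: (zclosure_mul I_closed).
- move=> R x /(throughE _ _ _ _ _ q0) xn.
  by apply/(throughE _ _ _ _ _ q0); apply: (zclosure_inv I_closed).
- move=> b /q0/zclosure_incl Ib; apply/p0 => J [_]; apply; left; by exists b.
- move=> h /q0 Ih; have [b nb hb] := NP i Ni h Ih.
  have [s [s0 hE]] := last_factor_kernel hb; exists s; split=> //.
  rewrite -(linear_sum p) -hE linearB /= ((p0 b).2 nb) subr0 //.
- by [].
Qed.

End Stabilization.

Theorem corollary4p2 (k : fieldType) (sigma : {rmorphism k -> k})
    (G : algGroup k) (I : set (diff_coord sigma G))
    (hI : sigma_closed_subgroup I) :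
  exists m : nat, forall i : nat, (m < i.+1)%N ->
    zclosure I i.+1 =
      ideal_gen (coord_incl sigma G i @` zclosure I i `|`
                 coord_shift sigma G i @` zclosure I i) /\
    forall R : comAlgType k,
      [set psi : {lrmorphism coord_prod sigma G i.+1 -> R} |
         vanishes_on psi (zclosure I i.+1)] =
      [set psi : {lrmorphism coord_prod sigma G i.+1 -> R} |
         vanishes_on (psi \o coord_incl sigma G i) (zclosure I i)] `&`
      [set psi : {lrmorphism coord_prod sigma G i.+1 -> R} |
         vanishes_on (psi \o coord_shift sigma G i) (zclosure I i)].
Proof.
have [m mP] := zclosure_next hI; exists m => i mi.
split=> [|R]; first exact: mP.
rewrite (mP i mi); apply/seteqP; split=> psi /=; by move/vanishes_on_next.
Qed.
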